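(* Let $V$ be an irreducible $\tau$-module with finite-dimensional weight spaces with respect to $\underline{\mathfrak h}=\mathring{\mathfrak h}\oplus\mathcal Z_0\oplus D$, where $\mathcal Z_0=\mathrm{span}(K_1,\dots,K_n)$. Let $L=\{\underline r,-\underline r:\ t^{\underline r}K_i\neq0\text{ on }V\text{ for some }i\}$ and let $k$ be the dimension of the $\mathbb C$-linear span of $L$. Then there is $B\in GL(n,\mathbb Z)$ such that the twisted module $V^{\sigma_B}$ satisfies: (1) there exist non-zero integers $m_1,\dots,m_k$ and non-zero central operators $z_1,\dots,z_k$ on it with $\deg z_i=(0,\dots,0,m_i,0,\dots,0)$ ($m_i$ in the $i$-th place); (2) $k<n$; (3) $t^{\underline r}K_i$ acts as $0$ for all $i$ and all $\underline r$ with $r_j\neq0$ for some $k+1\le j\le n$; (4) $t^{\underline r}K_i$ acts as $0$ for all $1\le i\le k$ and all $\underline r$; (5) there is a proper subspace $W$ which is a submodule for the subalgebra $\mathring{\mathfrak g}\otimes A\oplus\mathcal Z\oplus D_k$, $D_k=\mathrm{span}(d_{k+1},\dots,d_n)$, such that $V/W$ has finite-dimensional weight spaces with respect to $\mathring{\mathfrak h}\oplus\mathcal Z_0\oplus D_k$.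
   Context: Let $\mathring{\mathfrak g}$ be a finite-dimensional simple Lie algebra over $\mathbb C$ with Cartan subalgebra $\mathring{\mathfrak h}$ and a nondegenerate invariant symmetric bilinear form $(\cdot,\cdot)$. Fix $n\ge2$, $A=\mathbb C[t_1^{\pm1},\dots,t_n^{\pm1}]$, $t^{\underline m}=t_1^{m_1}\cdots t_n^{m_n}$. Let $\mathcal Z$ be spanned by symbols $t^{\underline m}K_i$ subject to $\sum_im_it^{\underline m}K_i=0$; $K_i=t^0K_i$; $d(t^{\underline r})t^{\underline s}=\sum_ir_it^{\underline r+\underline s}K_i$. The toroidal Lie algebra $\tau=\mathring{\mathfrak g}\otimes A\oplus\mathcal Z\oplus D$, $D=\mathrm{span}(d_1,\dots,d_n)$, has bracket $[X\otimes t^{\underline r},Y\otimes t^{\underline s}]=[X,Y]\otimes t^{\underline r+\underline s}+(X,Y)d(t^{\underline r})t^{\underline s}$, $\mathcal Z$ central in $\mathring{\mathfrak g}\otimes A\oplus\mathcal Z$, $[d_i,X\otimes t^{\underline r}]=r_iX\otimes t^{\underline r}$, $[d_i,t^{\underline m}K_j]=m_it^{\underline m}K_j$, $[d_i,d_j]=0$. A central operator of degree $\underline m\in\mathbb Z^n$ on a $\tau$-module $V$ is a linear map $z:V\to V$ commuting with the action of $\mathring{\mathfrak g}\otimes A\oplus\mathcal Z$ and satisfying $d_iz-zd_i=m_iz$ for all $i$. For $B\in GL(n,\mathbb Z)$, $\sigma_B$ is the automorphism of $\tau$ with $X\otimes t^{\underline r}\mapsto X\otimes t^{B\underline r}$,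 $d(t^{\underline r})t^{\underline s}\mapsto d(t^{B\underline r})t^{B\underline s}$, $d_i\mapsto\sum_k(B^{-1})_{ik}d_k$, and $V^{\sigma_B}$ is $V$ with action $x\cdot v=\sigma_B(x)v$. *)

(* Defs.v *)
From HB Require Import structures.
From mathcomp Require Import all_boot all_order all_algebra.
From mathcomp Require Import complex Rstruct.
Set Implicit Arguments. Unset Strict Implicit. Unset Printing Implicit Defensive.
Import Order.TTheory GRing.Theory Num.Theory.
Local Open Scope ring_scope.

Definition CC : numClosedFieldType := Rdefinitions.R[i].

Section Lie.
Variable G : vectType CC.
Variable br : G -> G -> G.

Definition is_lie_bracket : Prop :=
  (forall (a : CC) x y z, br (a *: x + y) z = a *: br x z + br y z) /\
  (forall (a : CC) x y z, br z (a *: x + y) = a *: br z x + br z y) /\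
  (forall x, br x x = 0) /\
  (forall x y z, br x (br y z) + br y (br z x) + br z (br x y) = 0).

Definition is_lie_ideal (I : {vspace G}) : Prop :=
  forall x y, y \in I -> br x y \in I.

Definition is_simple_lie : Prop :=
  (exists x y, br x y != 0) /\
  forall I : {vspace G}, is_lie_ideal I -> I = 0%VS \/ I = fullv.

Fixpoint nest (x : G) (s : seq G) : G :=
  match s with [::] => x | y :: s' => br x (nest y s') end.

Definition is_cartan (h : {vspace G}) : Prop :=
  (forall x y, x \in h -> y \in h -> br x y \in h) /\
  (exists N : nat, forall x (s : seq G), size s = N -> x \in h ->
      (forall y, y \in s -> y \in h) -> nest x s = 0) /\
  (forall x, (forall y, y \in h -> br x y \in h) -> x \in h).

Definition is_nondeg_invariant_form (form : G -> G -> CC) : Prop :=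
  (forall (a : CC) x y z, form (a *: x + y) z = a * form x z + form y z) /\
  (forall x y, form x y = form y x) /\
  (forall x y z, form (br x y) z = form x (br y z)) /\
  (forall x, (forall y, form x y = 0) -> x = 0).
End Lie.

(* degrees r in Z^n are column vectors 'cV[int]_n, r_i = r i 0 *)
Record tau_ops (n : nat) (G : vectType CC) (V : lmodType CC) := TauOps {
  opX : G -> 'cV[int]_n -> V -> V;        (* X (x) t^r *)
  opK : 'cV[int]_n -> 'I_n -> V -> V;     (* t^m K_i   *)
  opD : 'I_n -> V -> V                    (* d_i       *)
}.

Section Module.
Variables (n : nat) (G : vectType CC) (V : lmodType CC).
Implicit Types (rho : tau_ops n G V).

Definition lin_op (f : V -> V) : Prop :=
  forall (a : CC) u v, f (a *: u + v) = a *: f u + f v.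

Definition icast (z : int) : CC := z%:~R.

Definition is_tau_module (br : G -> G -> G) (form : G -> G -> CC) rho : Prop :=
  (forall X r, lin_op (opX rho X r)) /\
  (forall m i, lin_op (opK rho m i)) /\
  (forall i, lin_op (opD rho i)) /\
  (forall (a : CC) X Y r v,
      opX rho (a *: X + Y) r v = a *: opX rho X r v + opX rho Y r v) /\
  (* relations defining Z *)
  (forall (m : 'cV[int]_n) (v : V), \sum_(i < n) icast (m i 0) *: opK rho m i v = 0) /\
  (* [X t^r, Y t^s] = [X,Y] t^(r+s) + (X,Y) d(t^r) t^s *)
  (forall (X Y : G) (r s : 'cV[int]_n) (v : V),
      opX rho X r (opX rho Y s v) - opX rho Y s (opX rho X r v) =
      opX rho (br X Y) (r + s) v
      + form X Y *: \sum_(i < n) icast (r i 0) *: opK rho (r + s) i v) /\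
  (forall X r m i v, opX rho X r (opK rho m i v) = opK rho m i (opX rho X r v)) /\
  (forall m i m' j v, opK rho m i (opK rho m' j v) = opK rho m' j (opK rho m i v)) /\
  (forall (i : 'I_n) (X : G) (r : 'cV[int]_n) (v : V), opD rho i (opX rho X r v) - opX rho X r (opD rho i v)
                   = icast (r i 0) *: opX rho X r v) /\
  (forall (i : 'I_n) (m : 'cV[int]_n) (j : 'I_n) (v : V), opD rho i (opK rho m j v) - opK rho m j (opD rho i v)
                   = icast (m i 0) *: opK rho m j v) /\
  (forall i j v, opD rho i (opD rho j v) = opD rho j (opD rho i v)).

Definition is_subspace (W : V -> Prop) : Prop :=
  W 0 /\ forall (a : CC) u v, W u -> W v -> W (a *: u + v).

Definition invariant_sub rho (J : 'I_n -> Prop) (W : V -> Prop) : Prop :=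
  (forall X r v, W v -> W (opX rho X r v)) /\
  (forall m i v, W v -> W (opK rho m i v)) /\
  (forall j v, J j -> W v -> W (opD rho j v)).

Definition irreducible rho : Prop :=
  (exists v : V, v != 0) /\
  forall W, is_subspace W -> invariant_sub rho (fun _ => True) W ->
    (forall v, W v -> v = 0) \/ (forall v, W v).

Definition wt_vec_mod rho (h : {vspace G}) (W : V -> Prop) (J : 'I_n -> Prop)
    (lam : G -> CC) (c a : 'I_n -> CC) (v : V) : Prop :=
  (forall x, x \in h -> W (opX rho x 0 v - lam x *: v)) /\
  (forall i, W (opK rho 0 i v - c i *: v)) /\
  (forall j, J j -> W (opD rho j v - a j *: v)).

(* V/W is a weight module for h (+) Z_0 (+) span(d_j | J j)
   with finite-dimensional weight spaces *)
Definition fin_wt rho (h : {vspace G}) (W : V -> Prop) (J : 'I_n -> Prop) : Prop :=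
  (forall v, exists s : seq V,
      (forall w, w \in s -> exists lam c a, wt_vec_mod rho h W J lam c a w) /\
      W (v - \sum_(w <- s) w)) /\
  (forall lam c a, exists s : seq V, forall v, wt_vec_mod rho h W J lam c a v ->
      exists coef : 'I_(size s) -> CC,
        W (v - \sum_(i < size s) coef i *: s`_i)).

Definition central_op rho (m : 'cV[int]_n) (z : V -> V) : Prop :=
  lin_op z /\
  (forall X r v, opX rho X r (z v) = z (opX rho X r v)) /\
  (forall m' i v, opK rho m' i (z v) = z (opK rho m' i v)) /\
  (forall (i : 'I_n) (v : V), opD rho i (z v) - z (opD rho i v) = icast (m i 0) *: z v).

(* the twisted module V^{sigma_B}:
   X (x) t^r |-> X (x) t^{Br},
   t^m K_j |-> sum_i B_ij t^{Bm} K_i  (equivalent to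
       d(t^r) t^s |-> d(t^{Br}) t^{Bs}),
   d_i |-> sum_k (B^-1)_ik d_k *)
Definition twist (B : 'M[int]_n) rho : tau_ops n G V :=
  @TauOps n G V
    (fun X r => opX rho X (B *m r))
    (fun m j v => \sum_(i < n) icast (B i j) *: opK rho (B *m m) i v)
    (fun i v => \sum_(k < n) icast (invmx B i k) *: opD rho k v).

Definition cast_cV (r : 'cV[int]_n) : 'cV[CC]_n := map_mx icast r.

Definition Lset rho (w : 'cV[CC]_n) : Prop :=
  exists r : 'cV[int]_n, (exists i v, opK rho r i v != 0) /\
    (w = cast_cV r \/ w = - cast_cV r).

Definition L_span_dim (L : 'cV[CC]_n -> Prop) (k : nat) : Prop :=
  exists s : seq 'cV[CC]_n, (forall w, w \in s -> L w) /\
    (forall w, L w -> w \in <<s>>%VS) /\ \dim <<s>>%VS = k.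

Definition unit_deg (i : 'I_n) (m : int) : 'cV[int]_n :=
  \col_j (if j == i then m else 0).
End Module.

(* Main.v *)
Require Import Defs.
From HB Require Import structures.
From mathcomp Require Import all_boot all_order all_algebra.
From mathcomp Require Import complex Rstruct.
From mathcomp Require Import boolp.
Import Order.TTheory GRing.Theory Num.Theory.
Local Open Scope ring_scope.
Set Implicit Arguments.
Unset Strict Implicit.
Unset Printing Implicit Defensive.

(* By irreducibility a nonzero central operator is invertible, and its inverse
   is central of the opposite degree, so the degrees of products of the t^r K_i
   and their inverses form a subgroup of Z^n. The Smith normal form of a basis
   of the span of L taken from L gives B such that this subgroup, in the
   twisted coordinates, contains nonzero multiples m_i e_i for i < k, while L
   lies in the span of the first k coordinates. This is (1) and (3).

   For (4), if t^s K_i were nonzero for some i < k, the invertible central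
   operators would turn elements x t^r, y t^(s-r) of degree proportional to e_i
   and s into two endomorphisms of a finite-dimensional weight space whose
   commutator is a nonzero scalar. If k = n then (4) makes all t^r K_i vanish,
   so L is empty and k = 0; hence (2).

   For (5), let z_i be commuting central operators of degree m_i e_i and
   W = sum_i (z_i - 1) V. The z_i shift the weights freely, so V/W is nonzero;
   as the d-weights lie in one coset of Z^n, modulo W each d_i-weight, i < k,
   can be brought to one of |m_i| values. *)

(** * Linear operators and subspaces *)

Section LinOp.
Variables (V : lmodType CC) (f : V -> V).
Hypothesis linf : lin_op f.

Lemma lin_opD u v : f (u + v) = f u + f v.
Proof. by have := linf 1 u v; rewrite !scale1r. Qed.

Lemma lin_op0 : f 0 = 0.
Proof. by apply: (addrI (f 0)); rewrite -lin_opD !addr0. Qed.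

Lemma lin_opZ a u : f (a *: u) = a *: f u.
Proof. by have := linf a u 0; rewrite lin_op0 !addr0. Qed.

Lemma lin_opB u v : f (u - v) = f u - f v.
Proof. by rewrite lin_opD -scaleN1r lin_opZ scaleN1r. Qed.

Lemma lin_op_sum (J : Type) (r : seq J) (P : pred J) (g : J -> V) :
  f (\sum_(j <- r | P j) g j) = \sum_(j <- r | P j) f (g j).
Proof. exact: (big_morph f lin_opD lin_op0). Qed.

End LinOp.

Lemma lin_op_comp (V : lmodType CC) (f g : V -> V) :
  lin_op f -> lin_op g -> lin_op (f \o g).
Proof. by move=> lf lg a u v; rewrite /= lg lf. Qed.

Section Subspace.
Variables (V : lmodType CC) (W : V -> Prop).
Hypothesis subW : is_subspace W.

Lemma subspace0 : W 0. Proof. by case: subW. Qed.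

Lemma subspaceD u v : W u -> W v -> W (u + v).
Proof. by move=> Wu Wv; rewrite -[u]scale1r; apply: subW.2. Qed.

Lemma subspaceZ a u : W u -> W (a *: u).
Proof. by move=> Wu; rewrite -[_ *: _]addr0; apply: subW.2 => //; case: subW. Qed.

Lemma subspaceN u : W u -> W (- u).
Proof. by rewrite -scaleN1r; apply: subspaceZ. Qed.

Lemma subspaceB u v : W u -> W v -> W (u - v).
Proof. by move=> Wu Wv; apply: subspaceD => //; apply: subspaceN. Qed.

Lemma subspace_sum (J : eqType) (r : seq J) (P : pred J) (g : J -> V) :
  (forall j, j \in r -> P j -> W (g j)) -> W (\sum_(j <- r | P j) g j).
Proof.
move=> Wg; rewrite big_seq_cond; apply: (big_ind W); first exact: subspace0.
  exact: subspaceD.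
by move=> j /andP[jr Pj]; apply: Wg.
Qed.

End Subspace.

Definition zero_sub (V : lmodType CC) (v : V) : Prop := v = 0.

Lemma subspace_zero (V : lmodType CC) : is_subspace (@zero_sub V).
Proof. by split=> // a u v -> ->; rewrite /zero_sub scaler0 addr0. Qed.

(** * Joint eigenvectors *)

Lemma sum_by_key (K T : eqType) (M : nmodType) (s : seq T) (key : T -> K)
    (P : pred K) (g : T -> M) :
  \sum_(x <- s | P (key x)) g x =
  \sum_(c <- undup (map key s) | P c) \sum_(x <- s | key x == c) g x.
Proof.
rewrite (exchange_big_dep (fun x => P (key x))) /=; last first.
  by move=> c x Pc /eqP ->.
rewrite big_seq_cond [RHS]big_seq_cond; apply: eq_bigr => x /andP[xs Px].
rewrite -big_filter (_ : [seq c <- _ | _] = [:: key x]) ?big_seq1 //.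
transitivity [seq c <- undup (map key s) | c == key x].
  apply: eq_filter => c; rewrite [key x == c]eq_sym andbC.
  by case: eqP => // ->; rewrite Px.
rewrite filter_pred1_uniq ?undup_uniq // mem_undup.
exact: map_f.
Qed.

Section JointEigen.
Variables (V : lmodType CC) (I : Type) (F : I -> V -> V).
Hypothesis linF : forall i, lin_op (F i).

(** Taken modulo [W] so that the same lemmas serve the weight vectors of $V$ (with [zero_sub]) and
    those of $V/W$. *)
Definition eig_mod (W : V -> Prop) (c : I -> CC) (v : V) :=
  forall i, W (F i v - c i *: v).

Lemma eig_zeroP c v : eig_mod (@zero_sub V) c v <-> forall i, F i v = c i *: v.
Proof.
split=> H i; first by apply/eqP; rewrite -subr_eq0; apply/eqP/H.
by rewrite /zero_sub H subrr.
Qed.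

Lemma eig_modZ W c a v : is_subspace W -> eig_mod W c v -> eig_mod W c (a *: v).
Proof.
move=> sW H i; rewrite lin_opZ // scalerA mulrC -scalerA -scalerBr.
exact: subspaceZ.
Qed.

(** Induction on the number of terms: modulo [W], applying [F i - p0.1 i] to the sum kills the head
    [p0] and multiplies the [c]-component by the nonzero scalar [c i - p0.1 i]. *)
Lemma eig_components (W : V -> Prop) (subW : is_subspace W)
    (WF : forall i v, W v -> W (F i v)) (s : seq ((I -> CC) * V)) :
  (forall p, p \in s -> eig_mod W p.1 p.2) -> W (\sum_(p <- s) p.2) ->
  forall c, W (\sum_(p <- s | p.1 == c) p.2).
Proof.
move: {2}(size s) (erefl (size s)) => N; elim: N s => [|N IH] s.
  by move/size0nil=> -> _ _ c; rewrite big_nil; apply: subspace0.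
case: s => // p0 s [szs] eigs Wsum.
have off c : c <> p0.1 -> W (\sum_(p <- p0 :: s | p.1 == c) p.2).
  move=> nc; have [i ni] : exists i, c i != p0.1 i.
    apply: contrapT => nex; apply: nc; apply: funext => i.
    by apply: contrapT => /eqP ne; apply: nex; exists i.
  rewrite big_cons; case: eqP => [e|_]; first by case: nc.
  pose s1 := [seq (p.1, (p.1 i - p0.1 i) *: p.2) | p <- s].
  have /(_ c) : forall c, W (\sum_(p <- s1 | p.1 == c) p.2).
    apply: IH; first by rewrite size_map.
      move=> p /mapP[q qs ->] /=; apply: eig_modZ => //.
      by apply: eigs; rewrite inE qs orbT.
    rewrite big_map /=.
    have -> : \sum_(p <- s) (p.1 i - p0.1 i) *: p.2 =
      (F i (\sum_(p <- p0 :: s) p.2) - p0.1 i *: \sum_(p <- p0 :: s) p.2)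
      - \sum_(p <- p0 :: s) (F i p.2 - p.1 i *: p.2).
      rewrite lin_op_sum // scaler_sumr -!sumrB big_cons subrr add0r.
      by apply: eq_bigr => p _; rewrite opprB [RHS]addrC addrA subrK scalerBl.
    apply: subspaceB => //; last by apply: subspace_sum => // p ps _; apply: eigs.
    by apply: subspaceB => //; [apply: WF|apply: subspaceZ].
  rewrite big_map /=.
  have -> : \sum_(j <- s | j.1 == c) (j.1 i - p0.1 i) *: j.2 =
      (c i - p0.1 i) *: \sum_(j <- s | j.1 == c) j.2.
    by rewrite scaler_sumr; apply: eq_bigr => p /eqP ->.
  move/(subspaceZ subW (c i - p0.1 i)^-1).
  by rewrite scalerA mulVf ?scale1r // subr_eq0.
move=> c; have [->|] := EM (c = p0.1); last exact: off.
(* The component of the head itself is the whole sum minus all the other components, which are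
   settled by [off]. *)
have := Wsum; rewrite (bigID (fun p => p.1 == p0.1)) /=.
move/subspaceB => /(_ subW (\sum_(p <- p0 :: s | p.1 != p0.1) p.2)).
rewrite addrK; apply.
rewrite (sum_by_key _ fst (fun c => c != p0.1)).
by apply: subspace_sum => // d _ /eqP; apply: off.
Qed.

Definition eig_spanned := forall v, exists s : seq ((I -> CC) * V),
  (forall p, p \in s -> eig_mod (@zero_sub V) p.1 p.2) /\ v = \sum_(p <- s) p.2.

(** A linear map may be prescribed separately on each joint eigenspace: the components of a
    vanishing sum of eigenvectors vanish, so the value does not depend on the decomposition
    chosen. *)
Lemma eig_extend (f : (I -> CC) -> V -> V) :
  eig_spanned -> (forall c, lin_op (f c)) ->
  exists Phi : V -> V, lin_op Phi /\
    forall c v, eig_mod (@zero_sub V) c v -> Phi v = f c v.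
Proof.
move=> sp linf.
have key s : (forall p, p \in s -> eig_mod (@zero_sub V) p.1 p.2) ->
    \sum_(p <- s) p.2 = 0 -> \sum_(p <- s) f p.1 p.2 = 0.
  move=> es s0.
  rewrite (sum_by_key s fst xpredT (fun p => f p.1 p.2)).
  apply: big1 => c _.
  have -> : \sum_(p <- s | p.1 == c) f p.1 p.2 =
            f c (\sum_(p <- s | p.1 == c) p.2).
    by rewrite lin_op_sum //; apply: eq_bigr => p /eqP ->.
  rewrite (eig_components (subspace_zero V)) ?lin_op0 //.
  by move=> i v ->; rewrite /zero_sub lin_op0.
have [dec decP] := choice sp.
have comb (v : V) (s : seq ((I -> CC) * V)) :
    (forall p, p \in s -> eig_mod (@zero_sub V) p.1 p.2) ->
    v = \sum_(p <- s) p.2 ->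
    \sum_(p <- dec v) f p.1 p.2 = \sum_(p <- s) f p.1 p.2.
  move=> es vs; have [ed vd] := decP v.
  have /= := key (dec v ++ [seq (p.1, (-1) *: p.2) | p <- s]).
  rewrite !big_cat !big_map /= -scaler_sumr -vd -vs scaleN1r subrr.
  under [X in _ + X = 0]eq_bigr => p _ do rewrite lin_opZ //.
  rewrite -scaler_sumr scaleN1r => H; apply/eqP; rewrite -subr_eq0; apply/eqP.
  apply: H => // p; rewrite mem_cat => /orP[/ed //|/mapP[q /es eq ->]].
  by apply: eig_modZ => //; apply: subspace_zero.
exists (fun v => \sum_(p <- dec v) f p.1 p.2); split.
  move=> a u v; have [eu du] := decP u; have [ev dv] := decP v.
  rewrite (comb _ ([seq (p.1, a *: p.2) | p <- dec u] ++ dec v)).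
  - rewrite big_cat big_map /= scaler_sumr; congr (_ + _).
    by apply: eq_bigr => p _; rewrite lin_opZ.
  - move=> p; rewrite mem_cat => /orP[/mapP[q /eu eq ->]|/ev //].
    by apply: eig_modZ => //; apply: subspace_zero.
  - by rewrite big_cat big_map /= -scaler_sumr -du -dv.
move=> c v ev; rewrite (comb _ [:: (c, v)]) ?big_seq1 //.
by move=> p; rewrite inE => /eqP ->.
Qed.

Lemma eig_ext_eq (f g : V -> V) : eig_spanned -> lin_op f -> lin_op g ->
  (forall c v, eig_mod (@zero_sub V) c v -> f v = g v) -> f =1 g.
Proof.
move=> sp lf lg fg v; have [s [es ->]] := sp v.
rewrite !lin_op_sum // big_seq [RHS]big_seq.
by apply: eq_bigr => p /es/fg.
Qed.

End JointEigen.

(** * Finitely spanned subspaces *)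

(** Phrased through all subspaces containing [s], so that closure arguments need no coordinates;
    [inspanP] recovers the coefficients. *)
Definition inspan (V : lmodType CC) (s : seq V) (v : V) : Prop :=
  forall U : V -> Prop, is_subspace U -> (forall w, w \in s -> U w) -> U v.

Lemma inspan_subspace (V : lmodType CC) (s : seq V) : is_subspace (inspan s).
Proof.
split=> [U [] //|a u v su sv U sU Us].
by apply: sU.2; [apply: su|apply: sv].
Qed.

Lemma inspanP (V : lmodType CC) (s : seq V) v :
  inspan s v <->
  exists coef : 'I_(size s) -> CC, v = \sum_(i < size s) coef i *: s`_i.
Proof.
split=> [|[coef ->] U sU Us]; last first.
  apply: subspace_sum => // i _ _; apply: subspaceZ => //.
  by apply: Us; apply: mem_nth.
move/(_ (fun v => exists coef : 'I_(size s) -> CC,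
  v = \sum_(i < size s) coef i *: s`_i)); apply.
- split; first by exists (fun=> 0); rewrite big1 // => i _; rewrite scale0r.
  move=> a u w [cu ->] [cw ->]; exists (fun i => a * cu i + cw i).
  rewrite scaler_sumr -big_split; apply: eq_bigr => i _ /=.
  by rewrite scalerDl scalerA.
- move=> w /(nthP 0)[i lti <-]; exists (fun j => (j == i :> nat)%:R).
  rewrite (bigD1 (Ordinal lti)) //= eqxx scale1r big1 ?addr0 // => j ne.
  by case: eqP => [e|]; rewrite ?scale0r //; case/eqP: ne; apply: val_inj.
Qed.

Lemma inspan_fin_union (V : lmodType CC) (T : finType) (U : T -> V -> Prop) :
  (forall x, exists s, forall v, U x v -> inspan s v) ->
  exists s, forall x v, U x v -> inspan s v.
Proof.
move/choice=> [s sP]; exists (flatten [seq s x | x <- enum T]) => x v Uv.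
move=> Q subQ HQ; apply: (sP x v Uv) => // w ws; apply: HQ.
by apply/flattenP; exists (s x) => //; apply: map_f; rewrite mem_enum.
Qed.

(** An independent family in [U] has at most [size s] members, so one of maximal size exists; a
    vector outside its span would extend it. *)
Lemma inspan_basis (V : lmodType CC) (U : V -> Prop) (s : seq V) :
  is_subspace U -> (forall u, U u -> inspan s u) ->
  exists (d : nat) (e : nat -> V), [/\ forall i, (i < d)%N -> U (e i),
    forall x : nat -> CC, \sum_(i < d) x i *: e i = 0 ->
      forall i, (i < d)%N -> x i = 0
    & forall u, U u -> exists x : nat -> CC, u = \sum_(i < d) x i *: e i].
Proof.
move=> sU span.
pose indep (d : nat) (e : nat -> V) := (forall i, (i < d)%N -> U (e i)) /\
  forall x : nat -> CC, \sum_(i < d) x i *: e i = 0 ->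
      forall i, (i < d)%N -> x i = 0.
pose P d := `[< exists e, indep d e >].
have P0 : exists d, P d by exists 0%N; apply/asboolP; exists (fun=> 0).
have Pbound d : P d -> (d <= size s)%N.
  move/asboolP=> [e [Ue ind]]; rewrite leqNgt; apply/negP => lt.
  have /choice[C CP] : forall i : 'I_d, exists c : 'I_(size s) -> CC,
      e i = \sum_(j < size s) c j *: s`_j.
    by move=> i; apply: (inspanP s (e i)).1; apply: span; apply: Ue.
  (* With more rows than columns, the coordinate matrix has a nonzero left kernel, and each kernel
     row is a linear relation among the [e i]. *)
  pose M := \matrix_(i, j) C i j : 'M[CC]_(d, size s).
  have : kermx M != 0.
    rewrite -mxrank_eq0 mxrank_ker subn_eq0 -ltnNge.
    exact: leq_ltn_trans (rank_leq_col M) lt.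
  move=> /eqP; apply; apply/matrixP => i j; rewrite [RHS]mxE.
  pose x l := if insub l is Some l' then kermx M i l' else 0.
  have xE (l : 'I_d) : x l = kermx M i l by rewrite /x valK.
  rewrite -xE; apply: ind => //.
  under eq_bigr => l _ do rewrite CP scaler_sumr.
  rewrite exchange_big big1 //= => l _.
  under eq_bigr => q _ do rewrite scalerA.
  rewrite -scaler_suml.
  have /matrixP/(_ i l) := mulmx_ker M; rewrite [LHS]mxE [RHS]mxE => eq0.
  rewrite (eq_bigr (fun q => kermx M i q * M q l)) ?eq0 ?scale0r //.
  by move=> q _; rewrite xE [M q l]mxE.
have [d /asboolP[e [Ue ind]] dmax] := ex_maxnP P0 Pbound.
exists d, e; split=> // u Uu; apply: contrapT => nspan.
suff : P d.+1 by move/dmax; rewrite ltnn.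
apply/asboolP; exists (fun i => if i == d then u else e i); split.
  move=> i; rewrite ltnS leq_eqVlt; case: eqP => //= _; exact: Ue.
move=> x; rewrite big_ord_recr /= eqxx.
rewrite (eq_bigr (fun i : 'I_d => x i *: e i)); last first.
  by move=> i _; rewrite ltn_eqF.
move=> sum0; have xd : x d = 0.
  apply: contrapT => /eqP nx; apply: nspan.
  exists (fun i => - (x d)^-1 * x i).
  under eq_bigr => i _ do rewrite -scalerA.
  rewrite -scaler_sumr (_ : \sum_(i < d) _ = - (x d *: u)).
    by rewrite scalerN scaleNr opprK scalerA mulVf ?scale1r.
  by apply/eqP; rewrite -addr_eq0; apply/eqP.
move=> i; rewrite ltnS leq_eqVlt => /orP[/eqP -> //|]; apply: ind.
by rewrite xd scale0r addr0 in sum0.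
Qed.

(** On a space of dimension $d>0$ a commutator has trace $0$, while the scalar $c$ has trace
    $dc$. *)
Lemma commutator_scalar_eq0 (V : lmodType CC) (U : V -> Prop) (s : seq V)
    (a b : V -> V) (c : CC) :
  is_subspace U -> (forall u, U u -> inspan s u) -> lin_op a -> lin_op b ->
  (forall u, U u -> U (a u)) -> (forall u, U u -> U (b u)) ->
  (forall u, U u -> a (b u) - b (a u) = c *: u) ->
  (exists u, U u /\ u != 0) -> c = 0.
Proof.
move=> sU span la lb Ua Ub comm [u0 [Uu0 nz0]].
have [d [e [Ue ind spn]]] := inspan_basis sU span.
have mat f : (forall u, U u -> U (f u)) -> exists M : 'M[CC]_d,
    forall i : 'I_d, f (e i) = \sum_(j < d) M i j *: e j.
  move=> Uf; have /choice[C CP] : forall i : 'I_d, exists x : nat -> CC,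
      f (e i) = \sum_(j < d) x j *: e j by move=> i; apply: spn; apply: Uf; apply: Ue.
  exists (\matrix_(i, j) C i j) => i; rewrite CP.
  by apply: eq_bigr => j _; rewrite mxE.
have [A AP] := mat a Ua; have [B BP] := mat b Ub.
have d_gt0 : (0 < d)%N.
  case: d {Ue ind mat A AP B BP} spn => // /(_ _ Uu0)[x].
  by rewrite big_ord0 => u00; rewrite u00 eqxx in nz0.
have comp (f g : V -> V) (M N : 'M[CC]_d) : lin_op f ->
    (forall i : 'I_d, f (e i) = \sum_(j < d) M i j *: e j) ->
    (forall i : 'I_d, g (e i) = \sum_(j < d) N i j *: e j) ->
    forall i : 'I_d, f (g (e i)) = \sum_(j < d) (N *m M) i j *: e j.
  move=> lf fP gP i; rewrite gP lin_op_sum //.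
  under eq_bigr => j _ do rewrite lin_opZ // fP scaler_sumr.
  rewrite exchange_big; apply: eq_bigr => j _ /=.
  under eq_bigr => l _ do rewrite scalerA.
  by rewrite -scaler_suml mxE.
(* Matrices act on rows here, so composition reverses the order of the factors. *)
have eqBA : B *m A - A *m B = c%:M.
  apply/matrixP => i j; apply/eqP; rewrite -subr_eq0; apply/eqP.
  set D := B *m A - A *m B.
  pose x (l : nat) := if insub l is Some l' then D i l' - c%:M i l' else 0.
  have xE (l : 'I_d) : x l = D i l - c%:M i l by rewrite /x valK.
  rewrite -xE; apply: ind => //.
  have := comm (e i) (Ue i (ltn_ord i)).
  rewrite (comp a b A B) // (comp b a B A) // => /eqP.
  rewrite -subr_eq0 => /eqP cE; rewrite -[RHS]cE.
  under eq_bigr => l _ do rewrite xE scalerBl.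
  rewrite sumrB; congr (_ - _).
    by rewrite -sumrB; apply: eq_bigr => l _; rewrite -scalerBl /D !mxE.
  rewrite (bigD1 i) //= big1 ?addr0 => [|l ne]; first by rewrite mxE eqxx.
  by rewrite mxE eq_sym (negbTE ne) scale0r.
have := congr1 mxtrace eqBA.
rewrite raddfB /= mxtrace_mulC subrr mxtrace_scalar => /esym/eqP.
by rewrite -mulr_natr mulf_eq0 pnatr_eq0 eqn0Ngt d_gt0 orbF => /eqP.
Qed.

(** A subspace of maximal dimension inside [P] exhausts [P], since adjoining a missing vector of [P]
    would enlarge it. *)
Lemma vspace_of_pred (G : vectType CC) (P : G -> Prop) :
  P 0 -> (forall (a : CC) u v, P u -> P v -> P (a *: u + v)) ->
  exists I : {vspace G}, forall x, x \in I <-> P x.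
Proof.
move=> P0 PD.
pose Q d := `[< exists I : {vspace G}, \dim I = d /\ forall x, x \in I -> P x >].
have exQ : exists d, Q d.
  exists 0%N; apply/asboolP; exists 0%VS; split; first by rewrite dimv0.
  by move=> x; rewrite memv0 => /eqP ->.
have boundQ d : Q d -> (d <= \dim {:G})%N.
  by move=> /asboolP[I [<- _]]; apply: dimvS; apply: subvf.
have [d /asboolP[I [dI IP]] dmax] := ex_maxnP exQ boundQ.
exists I => x; split; first exact: IP.
move=> Px; apply: contrapT => /negP nIx.
suff /dmax : Q (\dim (<[x]> + I)%VS).
  rewrite -dI => le; case/negP: nIx.
  have /eqP -> : I == (<[x]> + I)%VS by rewrite eqEdim addvSr.
  exact: (subvP (addvSl _ _)) (memv_line x).
apply/asboolP; exists (<[x]> + I)%VS; split=> // y /memv_addP[_ /vlineP[a ->] [w Iw ->]].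
by apply: PD => //; apply: IP.
Qed.

(** * Central operators *)

Section CentralOperators.
Variables (n : nat) (G : vectType CC) (br : G -> G -> G) (form : G -> G -> CC).
Variables (V : lmodType CC) (rho : tau_ops n G V).
Hypothesis Hmod : is_tau_module br form rho.
Hypothesis Hirr : irreducible rho.

Lemma opX_lin X r : lin_op (opX rho X r).
Proof. by case: Hmod. Qed.

Lemma opK_lin m i : lin_op (opK rho m i).
Proof. by case: Hmod => _ []. Qed.

Lemma opD_lin i : lin_op (opD rho i).
Proof. by case: Hmod => _ [_ []]. Qed.

Lemma opX_linl a X Y r v :
  opX rho (a *: X + Y) r v = a *: opX rho X r v + opX rho Y r v.
Proof. by case: Hmod => _ [_ [_ []]]. Qed.

Lemma opK_rel (m : 'cV[int]_n) v : \sum_(i < n) icast (m i 0) *: opK rho m i v = 0.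
Proof. by case: Hmod => _ [_ [_ [_ []]]]. Qed.

Lemma opX_comm (X Y : G) (r s : 'cV[int]_n) (v : V) :
  opX rho X r (opX rho Y s v) - opX rho Y s (opX rho X r v) =
  opX rho (br X Y) (r + s) v
  + form X Y *: \sum_(i < n) icast (r i 0) *: opK rho (r + s) i v.
Proof. by case: Hmod => _ [_ [_ [_ [_ []]]]]. Qed.

Lemma opX_opK X r m i v : opX rho X r (opK rho m i v) = opK rho m i (opX rho X r v).
Proof. by case: Hmod => _ [_ [_ [_ [_ [_ []]]]]]. Qed.

Lemma opK_comm m i m' j v :
  opK rho m i (opK rho m' j v) = opK rho m' j (opK rho m i v).
Proof. by case: Hmod => _ [_ [_ [_ [_ [_ [_ []]]]]]]. Qed.

Lemma opD_opX (i : 'I_n) X (r : 'cV[int]_n) v :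
  opD rho i (opX rho X r v) - opX rho X r (opD rho i v)
  = icast (r i 0) *: opX rho X r v.
Proof. by case: Hmod => _ [_ [_ [_ [_ [_ [_ [_ []]]]]]]]. Qed.

Lemma opD_opK (i : 'I_n) (m : 'cV[int]_n) j v :
  opD rho i (opK rho m j v) - opK rho m j (opD rho i v)
  = icast (m i 0) *: opK rho m j v.
Proof. by case: Hmod => _ [_ [_ [_ [_ [_ [_ [_ [_ []]]]]]]]]. Qed.

Lemma opD_comm i j v : opD rho i (opD rho j v) = opD rho j (opD rho i v).
Proof. by case: Hmod => _ [_ [_ [_ [_ [_ [_ [_ [_ []]]]]]]]]. Qed.

Lemma opK_central m i : central_op rho m (opK rho m i).
Proof.
split; first exact: opK_lin.
split; first by move=> *; apply: opX_opK.
split; first by move=> *; apply: opK_comm.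
by move=> *; apply: opD_opK.
Qed.

Lemma central_opD (m : 'cV[int]_n) z : central_op rho m z -> forall i v,
  opD rho i (z v) = z (opD rho i v + icast (m i 0) *: v).
Proof.
move=> [lz [_ [_ zD]]] i v; rewrite lin_opD // [z (_ *: _)]lin_opZ // -zD.
by rewrite addrC subrK.
Qed.

(** A form of Schur's lemma: kernel and image of [z] are submodules, stable under $d_i$ because
    $d_iz=z(d_i+m_i)$, so irreducibility makes [z] bijective. *)
Lemma central_op_inverse (m : 'cV[int]_n) z :
  central_op rho m z -> (exists v, z v != 0) ->
  exists zi, [/\ cancel z zi, cancel zi z & central_op rho (- m) zi].
Proof.
move=> cz [v0 nz]; have [lz [zX [zK _]]] := cz; have zD := central_opD cz.
have [_ simple] := Hirr.
have zinj u v : z u = z v -> u = v.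
  move=> e; suff : z (u - v) = 0.
    have [] := simple (fun v => z v = 0).
    - split; first exact: lin_op0.
      by move=> a x y zx zy; rewrite lz zx zy scaler0 addr0.
    - split; first by move=> X r w zw; rewrite -zX zw lin_op0 //; apply: opX_lin.
      split; first by move=> r i w zw; rewrite -zK zw lin_op0 //; apply: opK_lin.
      move=> i w _ zw; have := zD i w; rewrite zw lin_op0; last exact: opD_lin.
      by rewrite lin_opD // [z (_ *: _)]lin_opZ // zw scaler0 addr0 => <-.
    - by move=> H /H/eqP; rewrite subr_eq0 => /eqP.
    - by move=> H _; rewrite H eqxx in nz.
  by rewrite lin_opB // e subrr.
have /choice[zi ziK] : forall v, exists u, z u = v.
  have [] := simple (fun v => exists u, z u = v).
  - split; first by exists 0; apply: lin_op0.
    by move=> a _ _ [x <-] [y <-]; exists (a *: x + y); apply: lz.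
  - split; first by move=> X r _ [w <-]; exists (opX rho X r w).
    split; first by move=> r i _ [w <-]; exists (opK rho r i w).
    by move=> i _ _ [w <-]; rewrite zD; eexists.
  - by move=> H; case/eqP: nz; apply: H; exists v0.
  - by [].
exists zi; split=> //; first by move=> v; apply: zinj; rewrite ziK.
split; first by move=> a u v; apply: zinj; rewrite lz !ziK.
split; first by move=> X r v; apply: zinj; rewrite -zX !ziK.
split; first by move=> r i v; apply: zinj; rewrite -zK !ziK.
move=> i v; apply: zinj; rewrite lin_opB // ziK.
rewrite [z (_ *: _)]lin_opZ // ziK mxE /icast rmorphN scaleNr.
have := zD i (zi v); rewrite ziK lin_opD // [z (_ *: _)]lin_opZ // ziK => ->.
by rewrite opprD addrA subrr add0r.
Qed.

Lemma central_op_comp m m' z y : central_op rho m z -> central_op rho m' y ->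
  central_op rho (m + m') (z \o y).
Proof.
move=> cz cy; have [lz [zX [zKK _]]] := cz; have [ly [yX [yKK _]]] := cy.
split; [exact: lin_op_comp|split; [|split]].
- by move=> X r v /=; rewrite zX yX.
- by move=> r i v /=; rewrite zKK yKK.
- move=> i v /=; rewrite (central_opD cz) (central_opD cy).
  rewrite (lin_opD ly) (lin_opZ ly) !(lin_opD lz) !(lin_opZ lz).
  rewrite [LHS]addrC !addrA addNr add0r -scalerDl mxE /icast rmorphD /=.
  by rewrite [in RHS]addrC.
Qed.

Lemma central_op_id : central_op rho 0 id.
Proof.
split=> //; split=> //; split=> // i v.
by rewrite subrr mxE /icast scale0r.
Qed.

(* Products of the operators t^m K_i and of their inverses lie in the
   bicommutant of these operators, which is why they commute. *)
Definition K_central (m : 'cV[int]_n) (z : V -> V) : Prop :=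
  central_op rho m z /\ (exists v, z v != 0) /\
  forall f, lin_op f ->
    (forall r i v, f (opK rho r i v) = opK rho r i (f v)) ->
    forall v, f (z v) = z (f v).

Definition K_degree (m : 'cV[int]_n) : Prop := exists z, K_central m z.

Lemma K_degree_opK m i v : opK rho m i v != 0 -> K_degree m.
Proof.
move=> nz; exists (opK rho m i); split; first exact: opK_central.
by split; [exists v|move=> f _; apply].
Qed.

Lemma K_degree0 : K_degree 0.
Proof.
by exists id; split; [exact: central_op_id|split; [case: Hirr|]].
Qed.

Lemma K_degreeN m : K_degree m -> K_degree (- m).
Proof.
move=> [z [cz [nz bz]]]; have [zi [ziK zK czi]] := central_op_inverse cz nz.
exists zi; split=> //; split.
  have [[v nv] _] := Hirr; exists (z v); by rewrite ziK.
by move=> f lf fK v; apply: (can_inj ziK); rewrite -bz // !zK.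
Qed.

Lemma K_degreeD m m' : K_degree m -> K_degree m' -> K_degree (m + m').
Proof.
move=> [z [cz [nz bz]]] [y [cy [ny by_]]].
have [zi [ziK zK czi]] := central_op_inverse cz nz.
exists (z \o y); split; first exact: central_op_comp.
split.
- have [v nv] := ny; exists v => /=; apply: contraNneq nv => e.
  by rewrite -[y v]ziK e lin_op0 //; case: czi.
- by move=> f lf fK v /=; rewrite bz // by_.
Qed.

Lemma K_degree_comb (T : finType) (u : T -> 'cV[int]_n) (c : T -> int) :
  (forall j, K_degree (u j)) -> K_degree (\sum_j u j *~ c j).
Proof.
move=> du; apply: (big_ind K_degree) => [||j _]; [exact: K_degree0|exact: K_degreeD|].
have dn q : K_degree (u j *+ q).
  elim: q => [|q IH]; first exact: K_degree0.
  by rewrite mulrS; apply: K_degreeD.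
by case: (c j) => q; [apply: dn|apply: K_degreeN; apply: dn].
Qed.

End CentralOperators.

(** * Weights *)

Section Weights.
Variables (n : nat) (G : vectType CC) (br : G -> G -> G) (form : G -> G -> CC).
Variables (h : {vspace G}) (V : lmodType CC) (rho : tau_ops n G V).
Hypothesis HLie : is_lie_bracket br.
Hypothesis Hsimple : is_simple_lie br.
Hypothesis Hcartan : is_cartan br h.
Hypothesis Hform : is_nondeg_invariant_form br form.
Hypothesis Hmod : is_tau_module br form rho.
Hypothesis Hirr : irreducible rho.
Hypothesis Hwt : fin_wt rho h (fun v => v = 0) (fun _ => True).

(* The three summands index h, the K_i and the d_j; in wop and wt_fun the d_j
   with j outside J are replaced by 0. *)
Definition wt_index : Type := subvs_of h + 'I_n + 'I_n.

Definition wop (J : pred 'I_n) (i : wt_index) : V -> V :=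
  match i with
  | inl (inl x) => opX rho (vsval x) 0
  | inl (inr i) => opK rho 0 i
  | inr j => if J j then opD rho j else fun=> 0
  end.

Definition wt_fun (J : pred 'I_n) (lam : G -> CC) (c a : 'I_n -> CC)
    (i : wt_index) : CC :=
  match i with
  | inl (inl x) => lam (vsval x)
  | inl (inr i) => c i
  | inr j => if J j then a j else 0
  end.

Lemma wop_lin J i : lin_op (wop J i).
Proof.
case: i => [[x|i]|j] /=; first exact: (opX_lin Hmod).
  exact: (opK_lin Hmod).
by case: (J j); [apply: (opD_lin Hmod)|move=> a u v; rewrite scaler0 addr0].
Qed.

(** For $j$ outside [J] both the operator and the eigenvalue are $0$, so the eigenvector condition
    there is vacuous. *)
Lemma wt_vec_modP (J : pred 'I_n) (JP : 'I_n -> Prop) W lam c a v :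
  is_subspace W -> (forall j, JP j <-> J j) ->
  wt_vec_mod rho h W JP lam c a v <->
  eig_mod (wop J) W (wt_fun J lam c a) v.
Proof.
move=> sW hJ; split=> [[wX [wK wD]] [[x|i]|j]|H] /=.
- by apply: wX; apply: subvsP.
- exact: wK.
- case e: (J j); first by apply: wD; apply/hJ.
  by rewrite scale0r subr0; apply: subspace0.
split=> [x xh|]; first by have := H (inl (inl (vsproj h x))); rewrite /= vsprojK.
split=> [i|j /hJ Jj]; first exact: (H (inl (inr i))).
by have := H (inr j); rewrite /= Jj.
Qed.

Lemma wt_funT chi : wt_fun xpredT (fun x => chi (inl (inl (vsproj h x))))
   (fun i => chi (inl (inr i))) (fun j => chi (inr j)) = chi.
Proof. by apply: funext => -[[x|i]|j] //=; rewrite vsvalK. Qed.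

Local Notation wt := (eig_mod (wop xpredT) (@zero_sub V)).

Lemma wt_decomp v : exists s : seq ((wt_index -> CC) * V),
  (forall p, p \in s -> wt p.1 p.2) /\ v = \sum_(p <- s) p.2.
Proof.
have [/(_ v)[s [sw /subr0_eq vs]] _] := Hwt.
have /choice[f fP] : forall w, exists chi, w \in s -> wt chi w.
  move=> w; have [ws|ws] := boolP (w \in s); last by exists (fun=> 0).
  have [lam [c [a H]]] := sw w ws; exists (wt_fun xpredT lam c a) => _.
  by apply/(wt_vec_modP (JP := fun=> True)); first exact: subspace_zero.
exists [seq (f w, w) | w <- s]; split; last by rewrite big_map.
by move=> p /mapP[w ws ->]; apply: fP.
Qed.

Lemma wt_spanned : eig_spanned (wop xpredT).
Proof. exact: wt_decomp. Qed.

Lemma wt_fin chi : exists s : seq V, forall v, wt chi v -> inspan s v.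
Proof.
have [_ /(_ (fun x => chi (inl (inl (vsproj h x)))) (fun i => chi (inl (inr i)))
  (fun j => chi (inr j)))[s sP]] := Hwt.
exists s => v wv; apply/inspanP.
have [|coef /subr0_eq ->] := sP v; last by exists coef.
apply/(wt_vec_modP (J := xpredT)) => //; first exact: subspace_zero.
by rewrite wt_funT.
Qed.

Lemma wt_exists : exists chi v, wt chi v /\ v != 0.
Proof.
have [[v nv] _] := Hirr; have [s [ws vs]] := wt_decomp v.
apply: contrapT => none; case/eqP: nv; rewrite vs big_seq big1 // => p ps.
by apply: contrapT => /eqP np; apply: none; exists p.1, p.2; split=> //; apply: ws.
Qed.

Lemma wt_subspace chi : is_subspace (wt chi).
Proof.
split=> [|a u v wu wv].
  by move=> i; rewrite lin_op0 ?scaler0 ?subrr //; apply: wop_lin.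
move/eig_zeroP: wu => wu; move/eig_zeroP: wv => wv; apply/eig_zeroP => i.
by rewrite wop_lin wu wv scalerDr !scalerA mulrC.
Qed.

Lemma form_ne0 x : x != 0 -> exists y, form x y != 0.
Proof.
move=> nx; apply: contrapT => none; case/eqP: nx.
have [_ [_ [_ nd]]] := Hform; apply: nd => y.
by apply: contrapT => /eqP ne; apply: none; exists y.
Qed.

(** If $\mathring{\mathfrak h}$ were zero, every element would normalise it and hence lie in it,
    making the bracket zero. *)
Lemma cartan_ne0 : exists2 x, x \in h & x != 0.
Proof.
apply: contrapT => none.
have h0 x : x \in h -> x = 0.
  by move=> xh; apply: contrapT => /eqP nx; apply: none; exists x.
have [_ [_ norm]] := Hcartan; have [[x [y /eqP nb]] _] := Hsimple; apply: nb.
have br0 z : br z 0 = 0.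
  have [_ [lr _]] := HLie; have := lr (-1) 0 0 z.
  by rewrite scaler0 addr0 scaleN1r addNr.
rewrite (h0 y) ?br0 //; apply: norm => z /h0 ->.
by rewrite br0 mem0v.
Qed.

(** Used for the central term of $[x\otimes t^r,y\otimes t^s]$ with $r=me_i$, which reduces to
    $(x,y)\,m\,t^{r+s}K_i$. *)
Lemma sum_unit_deg (i : 'I_n) (m : int) (g : 'I_n -> V) :
  \sum_(j < n) icast (unit_deg i m j 0) *: g j = icast m *: g i.
Proof.
rewrite (bigD1 i) //= mxE eqxx big1 ?addr0 // => j /negbTE ne.
by rewrite mxE ne /icast scale0r.
Qed.

(* The kernel of the action of g (x) 1 is an ideal; it contains [h, h] since h
   is diagonalisable on V, and if it were all of g then so would be [g, g] (x) A
   and with it the center. *)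
Lemma cartan_abelian : (exists r i v, opK rho r i v != 0) ->
  forall x y, x \in h -> y \in h -> br x y = 0.
Proof.
move=> [r0 [i0 [v0 nK]]].
have sumr0 (r s : 'cV[int]_n) v : r = 0 ->
    \sum_(i < n) icast (r i 0) *: opK rho s i v = 0.
  by move=> ->; apply: big1 => i _; rewrite mxE /icast scale0r.
have X0 r v : opX rho 0 r v = 0.
  have := opX_linl Hmod (-1) 0 0 r v.
  by rewrite scaler0 addr0 scaleN1r addNr.
have [N NP] : exists I : {vspace G}, forall x, x \in I <-> forall v, opX rho x 0 v = 0.
  apply: vspace_of_pred => // a u v u0 w0 x.
  by rewrite (opX_linl Hmod) u0 w0 scaler0 addr0.
have ideal : is_lie_ideal br N.
  move=> x y /NP y0; apply/NP => v.
  have := opX_comm Hmod x y 0 0 v.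
  rewrite sumr0 // scaler0 !addr0 !y0 subr0 => <-.
  by apply: lin_op0; apply: (opX_lin Hmod).
have [N0|NT] := Hsimple.2 N ideal.
  move=> x y xh yh; apply/eqP; rewrite -memv0 -N0; apply/NP.
  apply: (eig_ext_eq wt_spanned (f := opX rho (br x y) 0) (g := fun=> 0)).
  - exact: (opX_lin Hmod).
  - by move=> a u v; rewrite scaler0 addr0.
  move=> chi v /eig_zeroP wv.
  have ev z : z \in h -> opX rho z 0 v = chi (inl (inl (vsproj h z))) *: v.
    by move=> zh; have := wv (inl (inl (vsproj h z))); rewrite /= vsprojK.
  have := opX_comm Hmod x y 0 0 v; rewrite sumr0 // scaler0 !addr0 => <-.
  rewrite (ev x) // (ev y) // !(lin_opZ (opX_lin Hmod _ _)) (ev x) // (ev y) //.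
  by rewrite !scalerA; apply/eqP; rewrite subr_eq0 mulrC.
have all0 x v : opX rho x 0 v = 0.
  by have /NP : x \in N by rewrite NT memvf.
(* Commuting degree $r$ with degree $0$, the central term is the defining relation of $\mathcal Z$
   in degree $r$, hence zero. *)
have br0 x y r v : opX rho (br x y) r v = 0.
  have := opX_comm Hmod x y r 0 v.
  rewrite addr0 (opK_rel Hmod) scaler0 addr0 !all0 subr0 => <-.
  by apply: lin_op0; apply: (opX_lin Hmod).
have [[p [q nb]] _] := Hsimple; have [y ny] := form_ne0 nb.
(* Splitting [r0] as $e_{i_0}+(r_0-e_{i_0})$ isolates $t^{r_0}K_{i_0}$ in the central term, with the
   nonzero factor $([p,q],y)$. *)
have := opX_comm Hmod (br p q) y (unit_deg i0 1) (r0 - unit_deg i0 1) v0.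
rewrite !br0 lin_op0 ?subr0; last exact: (opX_lin Hmod).
rewrite (addrC (unit_deg i0 1)) subrK sum_unit_deg add0r /icast scale1r => /esym/eqP.
by rewrite scaler_eq0 (negbTE ny) (negbTE nK).
Qed.

(* If t^s K_i acts as an invertible operator T, then for x in h and (x, y) <> 0
   the operators z^-1 (x t^(m e_i)) and T^-1 z (y t^(s - m e_i)), the latter
   followed by the projection to a weight space, have the commutator m (x, y)
   on that weight space; its trace must vanish. *)
Lemma opK_eq0_of_central (i : 'I_n) (m : int) z :
  m != 0 -> central_op rho (unit_deg i m) z -> (exists v, z v != 0) ->
  forall s v, opK rho s i v = 0.
Proof.
move=> nm cz nz s v; apply: contrapT => /eqP nK.
have abel := cartan_abelian (ex_intro _ s (ex_intro _ i (ex_intro _ v nK))).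
have [x xh nx] := cartan_ne0; have [y ny] := form_ne0 nx.
have [zi [ziK zK czi]] := central_op_inverse Hmod Hirr cz nz.
have cT := opK_central Hmod s i.
have [Ti [TiK TK cTi]] := central_op_inverse Hmod Hirr cT (ex_intro _ v nK).
have [chi [v0 [wv0 nv0]]] := wt_exists.
set r := unit_deg i m in cz czi *.
have [lz [zX [zKK zD]]] := cz; have [lzi [ziX [ziKK ziD]]] := czi.
have [lTi [TiX [TiKK TiD]]] := cTi.
have lX := opX_lin Hmod.
pose a := zi \o opX rho x r.
have la : lin_op a by apply: lin_op_comp.
(* Identity on the weight [chi] and zero on the others: the resulting [pi] projects onto the weight
   space of [chi]. *)
have lf (c : wt_index -> CC) : lin_op (if c == chi then id else fun=> 0 : V).
  by case: (c == chi) => // b u w; rewrite scaler0 addr0.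
have [pi [lpi piP]] := eig_extend (@wop_lin xpredT) wt_spanned lf.
have sumr0 (q : 'cV[int]_n) w :
    \sum_(i < n) icast ((0 : 'cV[int]_n) i 0) *: opK rho q i w = 0.
  by apply: big1 => j _; rewrite mxE /icast scale0r.
have X0 q w : opX rho 0 q w = 0.
  have := opX_linl Hmod (-1) 0 0 q w.
  by rewrite scaler0 addr0 scaleN1r addNr.
(* The operator [a] has degree $0$ and $\mathring{\mathfrak h}$ is abelian, so [a] preserves every
   weight. *)
have aF j w : a (wop xpredT j w) = wop xpredT j (a w).
  case: j => [[t|j]|j] /=.
  - rewrite /a /= ziX; congr zi; apply/eqP; rewrite -subr_eq0; apply/eqP.
    rewrite (opX_comm Hmod) abel ?subvsP // X0 addr0 (opK_rel Hmod).
    by rewrite scaler0 addr0.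
  - by rewrite /a /= (opX_opK Hmod) ziKK.
  - rewrite /a /= (central_opD czi); congr zi.
    have := opD_opX Hmod j x r w; rewrite [(- r) j 0]mxE /icast rmorphN scaleNr.
    by move=> <-; rewrite opprB addrC subrK.
have awt c w : wt c w -> wt c (a w).
  move/eig_zeroP=> H; apply/eig_zeroP => j.
  by rewrite -aF H lin_opZ.
have piwt w : wt chi (pi w).
  have [t [tw ->]] := wt_decomp w; rewrite lin_op_sum //.
  apply: subspace_sum; first exact: wt_subspace.
  move=> p pt _; rewrite (piP _ _ (tw p pt)); case: eqP => [<-|_]; first exact: tw.
  exact: (subspace0 (wt_subspace chi)).
have pia w : pi (a w) = a (pi w).
  apply: (eig_ext_eq wt_spanned (f := pi \o a) (g := a \o pi));
    try exact: lin_op_comp.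
  move=> c u wu /=; rewrite (piP _ _ wu) (piP _ _ (awt _ _ wu)).
  by case: eqP => // _; rewrite lin_op0.
have piX w : pi (opX rho x 0 w) = chi (inl (inl (vsproj h x))) *: pi w.
  apply: (eig_ext_eq wt_spanned (f := pi \o opX rho x 0)
    (g := fun w => chi (inl (inl (vsproj h x))) *: pi w)).
  - exact: lin_op_comp.
  - by move=> b u u'; rewrite lpi scalerDr !scalerA mulrC.
  move=> c u wu /=.
  have /eig_zeroP/(_ (inl (inl (vsproj h x)))) /= := wu.
  rewrite vsprojK // => ->; rewrite lin_opZ // (piP _ _ wu).
  by case: eqP => [->//|_]; rewrite !scaler0.
have ziTi w : zi (Ti w) = Ti (zi w).
  by apply: (can_inj TiK); rewrite ziKK !TK.
(* The total degree is $-s+r+(s-r)=0$, but [y] need not commute with $\mathring{\mathfrak h}$; [pi]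
   brings the result back to the weight [chi]. *)
pose b := fun w => pi (Ti (z (opX rho y (s - r) w))).
have [t tP] := wt_fin chi.
suff /eqP : icast m * form x y = 0.
  by rewrite mulf_eq0 (negbTE ny) orbF /icast intr_eq0 (negbTE nm).
apply: (commutator_scalar_eq0 (a := a) (b := b) (wt_subspace chi) tP la).
- by move=> c u w; rewrite /b lX lz lTi lpi.
- exact: awt.
- by move=> u _; apply: piwt.
- move=> u wu; have piu : pi u = u by rewrite (piP _ _ wu) eqxx.
  have xu : opX rho x 0 u = chi (inl (inl (vsproj h x))) *: u.
    by have /eig_zeroP/(_ (inl (inl (vsproj h x)))) /= := wu; rewrite vsprojK.
  rewrite /b -pia /a /= TiX zX ziTi ziK ziX zK -(lin_opB lpi) -(lin_opB lTi).
  rewrite (opX_comm Hmod) (addrC r) subrK sum_unit_deg !(lin_opD lTi, lin_opD lpi).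
  rewrite !(lin_opZ lTi, lin_opZ lpi) TiK piu scalerA mulrC.
  (* What remains is [pi] of $T^{-1}([x,y]\otimes t^s)u=[x,T^{-1}(y\otimes t^s)]u$. It vanishes
     because $x$ acts by the same scalar on [u] and, after [pi], on the image. *)
  have := opX_comm Hmod x y 0 s u; rewrite sumr0 scaler0 addr0 add0r => <-.
  rewrite (lin_opB lTi) (lin_opB lpi) -TiX piX xu.
  by rewrite (lin_opZ (lX _ _)) (lin_opZ lTi) (lin_opZ lpi) subrr add0r.
- by exists v0.
Qed.

End Weights.

(** * The quotient by the periodicity operators *)

Lemma icast_inj : injective icast.
Proof. exact: intr_inj. Qed.

Lemma int_divmod_exists (m q : int) : m != 0 ->
  exists (l : int) (p : nat), q = m * l + p%:Z /\ (p < `|m|)%N.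
Proof.
move=> nm; exists (q %/ m)%Z, `|(q %% m)%Z|%N.
rewrite gez0_abs ?modz_ge0 // {1}(divz_eq q m) mulrC; split=> //.
by rewrite -ltz_nat gez0_abs ?modz_ge0 // ltz_mod.
Qed.

Section Powers.
Variables (T : Type) (z zi : T -> T).
Hypotheses (ziK : cancel z zi) (zK : cancel zi z).

(** Integer powers; [Negz a] stands for $-(a+1)$, whence [a.+1] iterations of the inverse. *)
Definition zpow (l : int) : T -> T :=
  match l with Posz a => iter a z | Negz a => iter a.+1 zi end.

Lemma zpow_succ l v : zpow l (z v) = zpow (l + 1) v.
Proof.
case: l => [a|[|a]]; first by rewrite -PoszD addn1 /= -iterSr.
  by rewrite NegzE addNr /= ziK.
have -> : Negz a.+1 + 1 = Negz a.
  by rewrite !NegzE -[a.+2]addn1 PoszD opprD subrK.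
by rewrite /zpow iterSr ziK.
Qed.

Lemma zpow_comm (y : T -> T) l v : (forall u, y (z u) = z (y u)) ->
  y (zpow l v) = zpow l (y v).
Proof.
move=> yz; have yzi u : y (zi u) = zi (y u) by rewrite -{2}[u]zK yz ziK.
have it (x : T -> T) a : (forall u, y (x u) = x (y u)) ->
    y (iter a x v) = iter a x (y v).
  by move=> yx; elim: a => //= a <-.
by case: l => a; apply: it.
Qed.

End Powers.

Section Quotient.
Variables (n : nat) (G : vectType CC) (br : G -> G -> G) (form : G -> G -> CC).
Variables (h : {vspace G}) (V : lmodType CC) (rho : tau_ops n G V).
Hypothesis Hmod : is_tau_module br form rho.
Hypothesis Hirr : irreducible rho.
Hypothesis Hwt : fin_wt rho h (fun v => v = 0) (fun _ => True).

Local Notation wt := (eig_mod (@wop n G h V rho xpredT) (@zero_sub V)).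

(** A central operator of degree [r] moves only the $d_j$-weights, by $r_j$. *)
Definition wt_shift (chi : wt_index n h -> CC) (r : 'cV[int]_n)
    (i : wt_index n h) : CC :=
  if i is inr j then chi i + icast (r j 0) else chi i.

Lemma central_op_wt r y chi v :
  central_op rho r y -> wt chi v -> wt (wt_shift chi r) (y v).
Proof.
move=> cy /eig_zeroP wv; have [ly [yX [yK _]]] := cy.
apply/eig_zeroP => -[[x|i]|j] /=.
- by rewrite yX [opX _ _ _ _](wv (inl (inl x))) lin_opZ.
- by rewrite yK [opK _ _ _ _](wv (inl (inr i))) lin_opZ.
- by rewrite (central_opD cy) [opD _ _ _](wv (inr j)) -scalerDl lin_opZ.
Qed.

Lemma zpow_central r (z zi : V -> V) l :
  central_op rho r z -> central_op rho (- r) zi ->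
  central_op rho (r *~ l) (zpow z zi l).
Proof.
move=> cz czi.
have it q y a : central_op rho q y -> central_op rho (q *+ a) (iter a y).
  move=> cy; elim: a => [|a IH]; first by rewrite mulr0n; apply: central_op_id.
  by rewrite mulrS; apply: central_op_comp.
by case: l => a; [|rewrite NegzE mulrNz -pmulrn -mulNrn]; apply: it.
Qed.

(** Sums of vectors with $d$-weights in [chi0] $+\,\mathbb Z^n$ form a nonzero submodule, hence all
    of $V$; by independence of eigenvectors no other $d$-weight can occur. *)
Lemma wt_coset chi0 v0 chi v : wt chi0 v0 -> v0 != 0 -> wt chi v -> v != 0 ->
  exists r : 'cV[int]_n, forall j, chi (inr j) = chi0 (inr j) + icast (r j 0).
Proof.
move=> w0 n0 wv nv.
pose hom (p : 'cV[int]_n * V) :=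
  forall j, opD rho j p.2 = (chi0 (inr j) + icast (p.1 j 0)) *: p.2.
pose S u := exists s : seq ('cV[int]_n * V),
  (forall p, p \in s -> hom p) /\ u = \sum_(p <- s) p.2.
have lD := opD_lin Hmod.
have Smap (f : V -> V) (g : 'cV[int]_n -> 'cV[int]_n) u : lin_op f ->
    (forall p, hom p -> hom (g p.1, f p.2)) -> S u -> S (f u).
  move=> lf H [s [hs ->]]; exists [seq (g p.1, f p.2) | p <- s].
  rewrite big_map lin_op_sum //; split=> // p /mapP[q /hs hq ->]; exact: H.
have subS : is_subspace S.
  split; first by exists [::]; rewrite big_nil.
  move=> a u w Su [s [hs ->]].
  have [|||t [ht ->]] := Smap (fun x => a *: x) id u; last 1 first.
  - exists (t ++ s); rewrite big_cat; split=> // p.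
    by rewrite mem_cat => /orP[/ht|/hs].
  - by move=> b x y; rewrite scalerDr !scalerA mulrC.
  - by move=> p hp j /=; rewrite lin_opZ // hp !scalerA mulrC.
  - exact: Su.
have invS : invariant_sub rho (fun=> True) S.
  split=> [X r u|]; last split=> [r i u|i u _].
  - apply: (Smap _ (fun q => q + r)); first exact: (opX_lin Hmod).
    move=> p hp j /=; have /eqP := opD_opX Hmod j X r p.2.
    rewrite hp (lin_opZ (opX_lin Hmod _ _)) subr_eq -scalerDl => /eqP ->.
    by rewrite mxE /icast rmorphD /= [in LHS]addrC addrA.
  - apply: (Smap _ (fun q => q + r)); first exact: (opK_lin Hmod).
    move=> p hp j /=; have /eqP := opD_opK Hmod j r i p.2.
    rewrite hp (lin_opZ (opK_lin Hmod _ _)) subr_eq -scalerDl => /eqP ->.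
    by rewrite mxE /icast rmorphD /= [in LHS]addrC addrA.
  - apply: (Smap _ id); first exact: lD.
    by move=> p hp j /=; rewrite (opD_comm Hmod) hp lin_opZ.
have [S0|/(_ v)[s [hs vs]]] := Hirr.2 S subS invS.
  case/eqP: n0; apply: S0; exists [:: (0, v0)]; rewrite big_seq1; split=> // p.
  rewrite inE => /eqP -> j /=; move/eig_zeroP: w0 => /(_ (inr j)) /= ->.
  by rewrite mxE /icast addr0.
pose a j := chi (inr j).
pose b (p : 'cV[int]_n * V) j := chi0 (inr j) + icast (p.1 j 0).
apply: contrapT => none.
(* Adding $-v$ to its decomposition gives sum zero; if no summand had the $d$-weight of $v$, that
   component would be $-v$ alone. *)
have := @eig_components V 'I_n (opD rho) lD _ (subspace_zero V) _
  ((a, - v) :: [seq (b p, p.2) | p <- s]) _ _ a.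
rewrite !big_cons !big_map /= eqxx -vs addNr => H.
have {H} : zero_sub (- v + \sum_(p <- s | b p == a) p.2).
  apply: H => [i u ->|p|//]; first by rewrite /zero_sub lin_op0.
  rewrite inE => /orP[/eqP ->|/mapP[q /hs hq ->]]; apply/eig_zeroP => j /=.
    rewrite -scaleN1r lin_opZ //.
    move/eig_zeroP: wv => /(_ (inr j)) /= ->.
    by rewrite !scalerA mulrC.
  exact: hq.
rewrite big1_seq => [|p /andP[/eqP e _]].
  by rewrite addr0 => /eqP; rewrite oppr_eq0 (negbTE nv).
by case: none; exists p.1 => j; rewrite -[LHS]/(a j) -e.
Qed.

Variables (k : nat) (m : 'I_n -> int) (z zi : 'I_n -> V -> V).
Hypothesis m_ne0 : forall i : 'I_n, (i < k)%N -> m i != 0.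
Hypothesis cz : forall i : 'I_n, (i < k)%N ->
  central_op rho (unit_deg i (m i)) (z i).
Hypothesis czi : forall i : 'I_n, (i < k)%N ->
  central_op rho (- unit_deg i (m i)) (zi i).
Hypothesis ziK : forall i : 'I_n, (i < k)%N -> cancel (z i) (zi i).
Hypothesis zK : forall i : 'I_n, (i < k)%N -> cancel (zi i) (z i).
Hypothesis zz : forall i j : 'I_n, (i < k)%N -> (j < k)%N ->
  forall v, z i (z j v) = z j (z i v).

Definition per_sub (v : V) : Prop :=
  exists u : 'I_n -> V, v = \sum_(i < n | (i < k)%N) (z i (u i) - u i).

Lemma per_subspace : is_subspace per_sub.
Proof.
have lz (i : 'I_n) (ik : (i < k)%N) : lin_op (z i) by case: (cz ik).
split.
  exists (fun=> 0); rewrite big1 // => i ik; rewrite lin_op0 ?subrr //.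
  exact: lz.
move=> a _ _ [u ->] [w ->]; exists (fun i => a *: u i + w i).
rewrite scaler_sumr -big_split; apply: eq_bigr => i ik /=.
by rewrite (lz i ik) scalerBr opprD addrACA.
Qed.

Lemma per_subP (i : 'I_n) v : (i < k)%N -> per_sub (z i v - v).
Proof.
move=> ik; exists (fun j => if j == i then v else 0).
rewrite (bigD1 i) //= eqxx big1 ?addr0 // => j /andP[jk /negbTE ->].
by rewrite lin_op0 ?subrr //; case: (cz jk).
Qed.

Lemma per_sub_zpow (i : 'I_n) l v : (i < k)%N -> per_sub (zpow (z i) (zi i) l v - v).
Proof.
move=> ik; have sW := per_subspace.
have it (y : V -> V) a : (forall u, per_sub (y u - u)) -> per_sub (iter a y v - v).
  move=> H; elim: a => [|a IH] /=; first by rewrite subrr; apply: subspace0.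
  rewrite -(subrK (iter a y v) (y _)) -addrA; exact: subspaceD.
case: l => a; apply: it => u; first exact: per_subP.
rewrite -opprB -{1}[u](zK ik); apply: subspaceN => //; exact: per_subP.
Qed.

Lemma per_sub_invariant : invariant_sub rho (fun j => (k <= j)%N) per_sub.
Proof.
split=> [X r _ [u ->]|]; last split=> [r i _ [u ->]|j _ kj [u ->]].
- exists (fun i => opX rho X r (u i)); rewrite lin_op_sum; last exact: (opX_lin Hmod).
  apply: eq_bigr => i ik; rewrite lin_opB; last exact: (opX_lin Hmod).
  by have [_ [-> _]] := cz ik.
- exists (fun j => opK rho r i (u j)); rewrite lin_op_sum; last exact: (opK_lin Hmod).
  apply: eq_bigr => j jk; rewrite lin_opB; last exact: (opK_lin Hmod).
  by have [_ [_ [-> _]]] := cz jk.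
- exists (fun i => opD rho j (u i)); rewrite lin_op_sum; last exact: (opD_lin Hmod).
  apply: eq_bigr => i ik; rewrite lin_opB; last exact: (opD_lin Hmod).
  (* As $i<k\le j$, the degree $m_ie_i$ has $j$-th coordinate $0$, so $d_j$ commutes with $z_i$. *)
  rewrite (central_opD (cz ik)) mxE /icast.
  case: eqP => [ji|_]; last by rewrite scale0r addr0.
  by move: kj; rewrite ji leqNgt ik.
Qed.

Lemma unit_deg_mulz (i j : 'I_n) l :
  (unit_deg i (m i) *~ l) j 0 = if j == i then m i * l else 0.
Proof.
rewrite (_ : unit_deg i (m i) *~ l = unit_deg i (m i * l)) ?mxE //.
apply/colP => q; rewrite -[_ *~ l]scaler_int !mxE.
by case: (q == i); rewrite ?mulr0 // intz mulrC.
Qed.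

(* On the weight spaces whose d_i-weight is x0 + m_i l act by z_i^-l, and by 0
   on the others. *)
Lemma per_retraction (i : 'I_n) (x0 : CC) : (i < k)%N ->
  exists phi : V -> V, [/\ lin_op phi, forall v, phi (z i v) = phi v,
    forall j : 'I_n, (j < k)%N -> j != i -> forall v, phi (z j v) = z j (phi v)
    & forall chi v, wt chi v -> chi (inr i) = x0 -> phi v = v].
Proof.
move=> ik; have lw := @wop_lin _ _ _ _ h _ _ Hmod xpredT.
have sp := wt_spanned Hwt.
pose inc x := exists l, x = x0 + icast (m i * l).
(* [L] reads off the exponent $l$ of a weight $x_0+m_il$, with default $0$ elsewhere; $m_i\neq0$
   makes it unique. *)
have /choice[L LP] : forall x, exists l, inc x -> x = x0 + icast (m i * l).
  move=> x; have [[l e]|nc] := EM (inc x); first by exists l.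
  by exists 0 => /nc.
have Lu x l : x = x0 + icast (m i * l) -> L x = l.
  move=> e; have := LP x (ex_intro _ l e); rewrite {1}e => /addrI/icast_inj.
  by move/(mulfI (m_ne0 ik)).
pose f (chi : wt_index n h -> CC) : V -> V :=
  if `[< inc (chi (inr i)) >] then zpow (z i) (zi i) (- L (chi (inr i)))
  else fun=> 0.
have lf chi : lin_op (f chi).
  rewrite /f; case: asboolP => _; last by move=> a u v; rewrite scaler0 addr0.
  by have [] := zpow_central (- L (chi (inr i))) (cz ik) (czi ik).
have [phi [lphi phiP]] := eig_extend lw sp lf.
have lz (j : 'I_n) (jk : (j < k)%N) : lin_op (z j) by case: (cz jk).
have wz (j : 'I_n) chi v (jk : (j < k)%N) (wv : wt chi v) := central_op_wt (cz jk) wv.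
exists phi; split=> //.
- apply: (eig_ext_eq sp (f := phi \o z i) (g := phi)) => //.
    by apply: lin_op_comp => //; apply: lz.
  move=> chi v wv /=; rewrite (phiP _ _ wv) (phiP _ _ (wz _ _ _ ik wv)) /f /=.
  (* If $z_iv$ has exponent $l$ then $v$ has exponent $l-1$, and $z_i^{-l}z_iv=z_i^{-(l-1)}v$. *)
  rewrite mxE eqxx; case: asboolP => [[l e]|nc].
    have e' : chi (inr i) = x0 + icast (m i * (l - 1)).
      rewrite mulrBr mulr1 /icast rmorphB /= -[_%:~R]/(icast _) addrA -e.
      by rewrite addrK.
    case: asboolP => [_|[]]; last by exists (l - 1).
    rewrite (Lu _ _ e) (Lu _ _ e') zpow_succ; last exact: ziK.
    by rewrite opprB addrC.
  case: asboolP => // -[l e]; case: nc; exists (l + 1).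
  by rewrite e mulrDr mulr1 /icast rmorphD /= addrA.
- move=> j jk ji.
  apply: (eig_ext_eq sp (f := phi \o z j) (g := z j \o phi));
    try by apply: lin_op_comp => //; apply: lz.
  move=> chi v wv /=; rewrite (phiP _ _ wv) (phiP _ _ (wz _ _ _ jk wv)) /f /=.
  rewrite mxE eq_sym (negbTE ji) /icast addr0.
  case: asboolP => _; last by rewrite lin_op0 //; apply: lz.
  rewrite (zpow_comm (ziK ik) (zK ik)) // => u; exact: zz.
- move=> chi v wv e; rewrite (phiP _ _ wv) /f e.
  have e0 : x0 = x0 + icast (m i * 0) by rewrite mulr0 /icast addr0.
  case: asboolP => [_|[]]; last by exists 0.
  by rewrite (Lu _ _ e0).
Qed.

(** The retractions for all $i<k$ compose to a map [phi] with $\phi z_i=\phi$ that fixes a nonzero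
    weight vector; it kills [per_sub], so that vector lies outside. *)
Lemma per_sub_proper : exists v, ~ per_sub v.
Proof.
have [chi [v0 [wv nv]]] := wt_exists Hirr Hwt; exists v0 => -[u v0E].
have [phi [lphi phi0 phiz]] : exists phi : V -> V, [/\ lin_op phi, phi v0 = v0
    & forall i : 'I_n, (i < k)%N -> forall v, phi (z i v) = phi v].
  have : exists phi : V -> V, [/\ lin_op phi, phi v0 = v0,
    forall i : 'I_n, (i < k)%N -> i \in enum 'I_n -> forall v, phi (z i v) = phi v
    & forall i : 'I_n, (i < k)%N -> i \notin enum 'I_n ->
        forall v, phi (z i v) = z i (phi v)].
    (* Each new retraction is applied first; it commutes with the other $z_j$, so the invariance
       already obtained persists. *)
    elim: (enum 'I_n) => [|i t [phi [lphi phi0 phit phint]]].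
      by exists id; split.
    have [ik|nik] := boolP (i < k)%N; last first.
      exists phi; split=> // j jk; rewrite inE.
        by case/orP=> [/eqP ji|]; [rewrite -ji jk in nik|apply: phit].
      by rewrite negb_or => /andP[_]; apply: phint.
    have [psi [lpsi psii psij psi0]] := per_retraction (chi (inr i)) ik.
    exists (phi \o psi); split.
    - exact: lin_op_comp.
    - by rewrite /= (psi0 _ _ wv).
    - move=> j jk; rewrite inE; have [-> _ v|ji /= jt v] := eqVneq j i.
        by rewrite /= psii.
      by rewrite psij // phit.
    - move=> j jk; rewrite inE negb_or => /andP[ji jt] v /=.
      by rewrite psij // phint.
  case=> phi [lphi phi0 phit _]; exists phi; split=> // i ik v.
  by rewrite phit // mem_enum.
case/eqP: nv; rewrite -phi0 v0E lin_op_sum // big1 // => i ik.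
by rewrite lin_opB // phiz // subrr.
Qed.

(** Divide $q_j$ by $m_j$ with quotient $l$: applying $z_j^{-l}$ changes nothing modulo [per_sub]
    and leaves the remainder as the $d_j$-offset. *)
Lemma per_sub_reduce (chi0 chi : wt_index n h -> CC) (q : 'I_n -> int) w : wt chi w ->
  (forall j, chi (inr j) = chi0 (inr j) + icast (q j)) ->
  exists (chi' : wt_index n h -> CC) (w' : V), [/\ per_sub (w' - w), wt chi' w',
    forall i, chi' (inl i) = chi (inl i),
    forall j : 'I_n, (k <= j)%N -> chi' (inr j) = chi (inr j)
    & forall j : 'I_n, (j < k)%N -> exists p : nat, (p < `|m j|)%N /\
        chi' (inr j) = chi0 (inr j) + icast p%:Z].
Proof.
move=> ww qP; have sW := per_subspace.
have : exists (chi' : wt_index n h -> CC) (w' : V), [/\ per_sub (w' - w), wt chi' w',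
    forall i, chi' (inl i) = chi (inl i),
    forall j : 'I_n, ~~ ((j < k) && (j \in enum 'I_n))%N -> chi' (inr j) = chi (inr j)
    & forall j : 'I_n, (j < k)%N -> j \in enum 'I_n -> exists p : nat,
       (p < `|m j|)%N /\ chi' (inr j) = chi0 (inr j) + icast p%:Z]; last first.
  move=> [chi' [w' [H1 H2 H3 H4 H5]]]; exists chi', w'; split=> //.
    by move=> j kj; apply: H4; rewrite ltnNge kj.
  by move=> j jk; apply: H5; rewrite ?mem_enum.
elim: (enum 'I_n) => [|i t [chi' [w' [H1 H2 H3 H4 H5]]]].
  by exists chi, w; rewrite subrr; split=> //; apply: subspace0.
have [/andP[ik nit]|] := boolP ((i < k) && (i \notin t))%N; last first.
  move=> ni; exists chi', w'; split=> // j; rewrite inE.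
    by move=> H; apply: H4; apply: contra H => /andP[-> ->]; rewrite orbT.
  move=> jk; have [ji _|_ /=] := eqVneq j i; last exact: H5.
  by apply: H5 => //; move: ni; rewrite -ji jk /= negbK.
have [l [p [qE pm]]] := int_divmod_exists (q i) (m_ne0 ik).
exists (wt_shift chi' (unit_deg i (m i) *~ (- l))), (zpow (z i) (zi i) (- l) w').
split.
- rewrite -(subrK w' (zpow _ _ _ _)) -addrA; apply: subspaceD => //.
  exact: per_sub_zpow.
- by apply: central_op_wt => //; apply: zpow_central; [apply: cz|apply: czi].
- by move=> j /=; rewrite H3.
- move=> j; rewrite inE /= unit_deg_mulz.
  have [->|_ /= H] := eqVneq j i; first by rewrite ik.
  by rewrite H4 // /icast addr0.
- move=> j jk; rewrite inE /= unit_deg_mulz.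
  have [-> _|_ /= jt] := eqVneq j i; last by rewrite /icast addr0; apply: H5.
  exists p; split=> //; rewrite H4 ?(negbTE nit) ?andbF // qP -addrA qE.
  by rewrite /icast -rmorphD /= mulrN addrAC subrr add0r.
Qed.

(** A weight vector of the quotient is represented by a sum of weight vectors of $V$ with the
    prescribed restricted weight; each can be moved into one of finitely many weight spaces of $V$,
    all finite-dimensional. *)
Lemma per_sub_fin_wt : fin_wt rho h per_sub (fun j => (k <= j)%N).
Proof.
have sW := per_subspace.
split.
  move=> v; have [/(_ v)[s [ws /subr0_eq vs]] _] := Hwt.
  exists s; split; last by rewrite {1}vs subrr; apply: subspace0.
  move=> w /ws[lam [c [a [wX [wK wD]]]]]; exists lam, c, a; split.
    by move=> x /wX ->; apply: subspace0.
  by split=> [i|j _]; rewrite ?wK ?wD //; apply: subspace0.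
move=> lam c a.
pose J : pred 'I_n := fun j => (k <= j)%N.
have [chi0 [v0 [wv0 nv0]]] := wt_exists Hirr Hwt.
(* A single bound above every $|m_j|$, so that the tuples of residues range over a finite type. *)
pose N := (\sum_(i < n) `|m i|%N).+1.
pose chis (p : {ffun 'I_n -> 'I_N}) (i : wt_index n h) : CC :=
  match i with
  | inl _ => wt_fun J lam c a i
  | inr j => if J j then a j else chi0 (inr j) + icast (p j)%:Z
  end.
have [s sP] := inspan_fin_union (fun p => wt_fin Hwt (chis p)).
exists s => v.
move=> /(wt_vec_modP h rho lam c a v sW (fun j => iff_refl (J j))) wv.
pose Q u := exists u', inspan s u' /\ per_sub (u - u').
have sQ : is_subspace Q.
  have sS := inspan_subspace s.
  split; first by exists 0; rewrite subrr; split; apply: subspace0.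
  move=> b x y [x' [sx Wx]] [y' [sy Wy]]; exists (b *: x' + y').
  split; first exact: sS.2.
  by rewrite opprD addrACA -scalerBr; apply: sW.2.
suff [v' [/inspanP[coef ->] Wv]] : Q v by exists coef.
(* Restriction of a weight to $\mathring{\mathfrak h}\oplus\mathcal Z_0\oplus D_k$. *)
pose res (chi : wt_index n h -> CC) (i : wt_index n h) :=
  if i is inr j then if J j then chi i else 0 else chi i.
have [t [wt_t vt]] := wt_decomp Hwt v.
(* Since $v$ is a weight vector modulo [per_sub], it agrees there with the part of its decomposition
   having its restricted weight. *)
have := @eig_components V _ (wop rho J) (wop_lin Hmod J) _ sW _
  ((wt_fun J lam c a, - v) :: [seq (res p.1, p.2) | p <- t]) _ _
  (wt_fun J lam c a).
rewrite !big_cons !big_map /= eqxx -vt addNr => H.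
have {H} Wv : per_sub (- v + \sum_(p <- t | res p.1 == wt_fun J lam c a) p.2).
  apply: H => [i u|p|]; last exact: subspace0.
    have [iX [iK iD]] := per_sub_invariant.
    case: i => [[x|i]|j] /=; [exact: iX|exact: iK|].
    by case e: (J j); [apply: iD|move=> _; apply: subspace0].
  rewrite inE => /orP[/eqP ->|/mapP[r /wt_t wr ->]] /=.
    rewrite -scaleN1r; apply: eig_modZ => //; exact: (wop_lin Hmod).
  move=> i; have {wr} /eig_zeroP/(_ i) := wr.
  case: i => [[x|i]|j] /=; try by move=> ->; rewrite subrr; apply: subspace0.
  move=> e; case: (J j); first by rewrite e subrr; apply: subspace0.
  by rewrite scale0r subr0; apply: subspace0.
have -> : v = \sum_(p <- t | res p.1 == wt_fun J lam c a) p.2 -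
   (- v + \sum_(p <- t | res p.1 == wt_fun J lam c a) p.2).
  by rewrite opprD opprK addrC subrK.
apply: subspaceB => //; last first.
  exists 0; rewrite subr0; split=> //; exact: (subspace0 (inspan_subspace s)).
apply: subspace_sum => // p pt /eqP rp.
have [->|np] := eqVneq p.2 0; first exact: subspace0.
have [q qP] := wt_coset wv0 nv0 (wt_t p pt) np.
have [chi' [w' [H1 H2 H3 H4 H5]]] := per_sub_reduce (wt_t p pt) qP.
exists w'; split; last by rewrite -opprB; apply: subspaceN.
have /choice[f fP] : forall j : 'I_n, exists r : 'I_N, (j < k)%N ->
    chi' (inr j) = chi0 (inr j) + icast r%:Z.
  move=> j; have [jk|] := boolP (j < k)%N; last by exists ord0.
  have [r [rm re]] := H5 j jk.
  have rN : (r < N)%N.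
    rewrite ltnS; apply: leq_trans (ltnW rm) _.
    by rewrite (bigD1 j) //= leq_addr.
  by exists (Ordinal rN).
apply: (sP (finfun f)); suff -> : chis (finfun f) = chi' by [].
apply: funext => -[i|j] /=.
  by rewrite H3; have := congr1 (fun g => g (inl i)) rp.
rewrite ffunE; case e: (J j); last by rewrite fP // ltnNge -/(J j) e.
rewrite H4 //; have := congr1 (fun g => g (inr j)) rp => /=.
by rewrite e.
Qed.

End Quotient.

(** * Twisting by GL(n, Z) *)

Section Twist.
Variables (n : nat) (G : vectType CC) (br : G -> G -> G) (form : G -> G -> CC).
Variables (h : {vspace G}) (V : lmodType CC) (rho : tau_ops n G V).
Variable B : 'M[int]_n.
Hypothesis uB : B \in unitmx.
Hypothesis Hmod : is_tau_module br form rho.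

Lemma icast_mulmx p (A : 'M[int]_(p, n)) (r : 'cV[int]_n) i :
  icast ((A *m r) i 0) = \sum_(j < n) icast (A i j) * icast (r j 0).
Proof.
rewrite mxE /icast rmorph_sum; apply: eq_bigr => j _.
by rewrite rmorphM.
Qed.

(** With [A] $=B$ this is the rule $d(t^r)t^s\mapsto d(t^{Br})t^{Bs}$ in coordinates. *)
Lemma sum_mulmx p (A : 'M[int]_(p, n)) (r : 'cV[int]_n) (g : 'I_p -> V) :
  \sum_(j < n) icast (r j 0) *: (\sum_(i < p) icast (A i j) *: g i) =
  \sum_(i < p) icast ((A *m r) i 0) *: g i.
Proof.
under eq_bigr => j _ do rewrite scaler_sumr.
rewrite exchange_big; apply: eq_bigr => i _; rewrite icast_mulmx scaler_suml.
by apply: eq_bigr => j _; rewrite scalerA mulrC.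
Qed.

Lemma lin_op_comb (T : finType) (c : T -> CC) (f : T -> V -> V) :
  (forall i, lin_op (f i)) -> lin_op (fun v => \sum_i c i *: f i v).
Proof.
move=> lf a u v; rewrite scaler_sumr -big_split; apply: eq_bigr => i _ /=.
by rewrite lf scalerDr !scalerA mulrC.
Qed.

(** This and the next two lemmas invert $\sigma_B$, so that invariance and weights can be carried
    between the two modules. *)
Lemma opX_twist X r v : opX rho X r v = opX (twist B rho) X (invmx B *m r) v.
Proof. by rewrite /= mulKVmx. Qed.

Lemma opK_twist r i v : opK rho r i v =
  \sum_(j < n) icast (invmx B j i) *: opK (twist B rho) (invmx B *m r) j v.
Proof.
rewrite /= mulKVmx //.
transitivity (\sum_(j < n) icast (col i (invmx B) j 0) *:
    (\sum_(l < n) icast (B l j) *: opK rho r l v)); last first.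
  by apply: eq_bigr => j _; rewrite mxE.
rewrite sum_mulmx colE mulKVmx // (bigD1 i) //= big1 ?addr0.
  by rewrite !mxE eqxx /icast scale1r.
by move=> j /negbTE ne; rewrite !mxE ne /icast scale0r.
Qed.

Lemma opD_twist i v : opD rho i v =
  \sum_(k < n) icast (B i k) *: opD (twist B rho) k v.
Proof.
have inv j : \sum_(k < n) icast (B i k) * icast (invmx B k j) = (i == j)%:R.
  have /matrixP/(_ i j)/(congr1 icast) := mulmxV uB.
  rewrite !mxE /icast rmorph_sum /= => e.
  transitivity ((i == j)%:R%:~R : CC); last by case: (i == j).
  by rewrite -e; apply: eq_bigr => k _; rewrite rmorphM.
rewrite /=; under eq_bigr => k _ do rewrite scaler_sumr.
rewrite exchange_big /= (bigD1 i) //= [X in _ + X]big1 ?addr0 => [|j ne].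
  under eq_bigr => k _ do rewrite scalerA.
  by rewrite -scaler_suml inv eqxx scale1r.
under eq_bigr => k _ do rewrite scalerA.
by rewrite -scaler_suml inv eq_sym (negbTE ne) scale0r.
Qed.

Lemma twist_tau_module : is_tau_module br form (twist B rho).
Proof.
have lX := opX_lin Hmod; have lK := opK_lin Hmod; have lD := opD_lin Hmod.
have invB (r : 'cV[int]_n) i (u : V) :
    \sum_(j < n) icast (invmx B i j) *: (icast ((B *m r) j 0) *: u) =
    icast (r i 0) *: u.
  rewrite -{2}[r](mulKmx uB) icast_mulmx scaler_suml.
  by apply: eq_bigr => j _; rewrite scalerA.
split; first by move=> X r; apply: lX.
split; first by move=> r i; apply: lin_op_comb => j; apply: lK.
split; first by move=> i; apply: lin_op_comb => j; apply: lD.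
split; first by move=> a X Y r v; apply: (opX_linl Hmod).
split; first by move=> r v; rewrite /= sum_mulmx (opK_rel Hmod).
split.
  by move=> X Y r s v; rewrite /= (opX_comm Hmod) sum_mulmx mulmxDr.
split.
  move=> X r q i v /=; rewrite lin_op_sum //; apply: eq_bigr => j _.
  by rewrite lin_opZ // (opX_opK Hmod).
split.
  move=> r i q j v /=.
  under eq_bigr => l _ do rewrite lin_op_sum // scaler_sumr.
  under [RHS]eq_bigr => l _ do rewrite lin_op_sum // scaler_sumr.
  rewrite exchange_big; apply: eq_bigr => l _; apply: eq_bigr => l' _ /=.
  by rewrite !(lin_opZ (lK _ _)) (opK_comm Hmod) !scalerA mulrC.
split.
  move=> i X r v /=; rewrite lin_op_sum // -sumrB -[RHS]invB.
  by apply: eq_bigr => j _; rewrite lin_opZ // -scalerBr (opD_opX Hmod).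
split.
  move=> i r j v /=.
  rewrite -[RHS]invB.
  under eq_bigr => l _ do rewrite lin_op_sum // scaler_sumr.
  under [X in _ - X]eq_bigr => l _ do rewrite lin_op_sum // scaler_sumr.
  rewrite [X in _ - X]exchange_big /= -sumrB; apply: eq_bigr => l _.
  rewrite -sumrB !scaler_sumr; apply: eq_bigr => l' _.
  rewrite (lin_opZ (lD _)) (lin_opZ (lK _ _)) !scalerA -[in X in _ - X]mulrC -!scalerA -!scalerBr.
  rewrite (opD_opK Hmod) !scalerA; congr (_ *: _).
  by rewrite -!mulrA; congr (_ * _); rewrite mulrC.
move=> i j v /=.
under eq_bigr => l _ do rewrite lin_op_sum // scaler_sumr.
under [RHS]eq_bigr => l _ do rewrite lin_op_sum // scaler_sumr.
rewrite exchange_big; apply: eq_bigr => l _; apply: eq_bigr => l' _ /=.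
by rewrite !(lin_opZ (lD _)) (opD_comm Hmod) !scalerA mulrC.
Qed.

Lemma twist_irreducible : irreducible rho -> irreducible (twist B rho).
Proof.
move=> [nz simple]; split=> // W sW [WX [WK WD]]; apply: simple => //.
split=> [X r v Wv|]; first by rewrite opX_twist; apply: WX.
split=> [r i v Wv|j v _ Wv].
  rewrite opK_twist; apply: subspace_sum => // j _ _; apply: subspaceZ => //.
  exact: WK.
rewrite opD_twist; apply: subspace_sum => // i _ _; apply: subspaceZ => //.
exact: WD.
Qed.

(** The weight spaces stay the same; only their labels change, [c] by the transpose of $B$ and [a]
    by $B^{-1}$. *)
Lemma twist_fin_wt : fin_wt rho h (fun v => v = 0) (fun _ => True) ->
  fin_wt (twist B rho) h (fun v => v = 0) (fun _ => True).
Proof.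
move=> [dec fin]; split.
  move=> v; have [s [ws vs]] := dec v; exists s; split=> // w /ws.
  move=> [lam [c [a [wX [wK wD]]]]].
  exists lam, (fun j => \sum_i icast (B i j) * c i),
    (fun i => \sum_k icast (invmx B i k) * a k); split.
    by move=> x /wX; rewrite /= mulmx0.
  split=> [j|i _] /=; apply/eqP; rewrite subr_eq0 scaler_suml; apply/eqP;
    apply: eq_bigr => l _; rewrite -scalerA; congr (_ *: _); apply: subr0_eq.
    by rewrite mulmx0.
  exact: wD.
move=> lam c a.
have [s sP] := fin lam (fun i => \sum_j icast (invmx B j i) * c j)
  (fun i => \sum_k icast (B i k) * a k).
exists s => v [wX [wK wD]]; apply: sP; split.
  by move=> x /wX; rewrite /= mulmx0.
split=> [i|i _]; apply/eqP; rewrite subr_eq0 ?opK_twist ?opD_twist scaler_suml;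
  apply/eqP; apply: eq_bigr => l _; rewrite -scalerA; congr (_ *: _);
  apply: subr0_eq.
  by have := wK l; rewrite /= !mulmx0.
exact: wD.
Qed.

Lemma opK_twist_ne0 r i v : opK rho r i v != 0 ->
  exists j, opK (twist B rho) (invmx B *m r) j v != 0.
Proof.
move=> nz; apply: contrapT => none; case/eqP: nz; rewrite opK_twist.
apply: big1 => j _; apply/eqP; rewrite scaler_eq0; apply/orP; right.
by apply/negPn/negP => ne; apply: none; exists j.
Qed.

Lemma twist_opK_ne0 r i v : opK (twist B rho) r i v != 0 ->
  exists j, opK rho (B *m r) j v != 0.
Proof.
move=> nz; apply: contrapT => none; case/eqP: nz => /=.
apply: big1 => j _; apply/eqP; rewrite scaler_eq0; apply/orP; right.
by apply/negPn/negP => ne; apply: none; exists j.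
Qed.

End Twist.

(** * Bases of the span of $L$ and adapted lattice coordinates *)

Lemma free_subfamily (K : fieldType) (vT : vectType K) (s : seq vT) :
  exists t : seq vT, [/\ {subset t <= s}, free t & <<t>>%VS = <<s>>%VS].
Proof.
elim: s => [|w s [t [ts ft et]]]; first by exists [::]; rewrite nil_free.
have [wt|wt] := boolP (w \in <<t>>%VS).
  exists t; split=> //; first by move=> x /ts xs; rewrite inE xs orbT.
  by rewrite span_cons -et; apply/esym/addv_idPr; rewrite -memvE.
exists (w :: t); split; last by rewrite !span_cons et.
  by move=> x; rewrite !inE => /orP[->//|/ts ->]; rewrite orbT.
by rewrite free_cons wt.
Qed.

(* Via the Smith normal form [u_1 ... u_k] = B D Q. *)
Lemma adapted_basis (n k : nat) (u : 'I_k -> 'cV[int]_n) :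
  (forall x : 'I_k -> int, \sum_j u j *~ x j = 0 -> forall j, x j = 0) ->
  exists2 B : 'M[int]_n, B \in unitmx &
    (forall (j : 'I_k) (i : 'I_n), (k <= i)%N -> (invmx B *m u j) i 0 = 0) /\
    (forall i : 'I_n, (i < k)%N -> exists (m : int) (c : 'I_k -> int),
       m != 0 /\ unit_deg i m = \sum_j (invmx B *m u j) *~ c j).
Proof.
move=> ind; pose M := \matrix_(i < n, j < k) u j i 0.
have [B uB [Q uQ [d _ ME]]] := int_Smith_normal_form M.
set D := (\matrix_(i, j) _) in ME.
have uE j : u j = col j M by apply/colP => i; rewrite !mxE.
have BuE j : invmx B *m u j = col j (D *m Q).
  by rewrite uE !colE ME -!mulmxA mulKmx.
have comb (x : 'cV[int]_k) (A : 'M[int]_(n, k)) :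
    A *m x = \sum_j col j A *~ x j 0.
  apply/colP => i; rewrite mxE summxE; apply: eq_bigr => j _.
  by rewrite -[_ *~ _]scaler_int !mxE intz mulrC.
exists B => //; split.
  move=> j i ki; rewrite BuE !mxE big1 // => l _; rewrite mxE.
  case: eqP => [e|_]; last by rewrite mulr0n mul0r.
  by move: (ltn_ord l); rewrite -e ltnNge ki.
move=> i ik; pose i' := Ordinal ik.
(* With $x=Q^{-1}e_i$ the factorisation gives $B^{-1}Mx=De_i=d_ie_i$, so [x] holds the required
   coefficients. *)
pose x := invmx Q *m (delta_mx i' 0 : 'cV[int]_k).
have DE : D *m delta_mx i' 0 = unit_deg i d`_i.
  apply/colP => l; rewrite -colE !mxE -(inj_eq val_inj) /=.
  by have [->|] := eqVneq (l : nat) (i : nat).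
exists d`_i, (fun j => x j 0); split; last first.
  under eq_bigr => j _ do rewrite BuE.
  by rewrite -comb /x -mulmxA mulKVmx // DE.
(* If $d_i=0$ then $Mx=0$, so independence forces $x=0$, against $Qx=e_i$. *)
apply/eqP => d0.
have x0 : x = 0.
  apply/colP => j; rewrite [RHS]mxE; apply: (ind (fun j => x j 0)).
  under eq_bigr => l _ do rewrite uE.
  rewrite -comb ME /x -!mulmxA mulKVmx // DE d0.
  rewrite (_ : unit_deg i 0 = 0) ?mulmx0 //.
  by apply/colP => l; rewrite !mxE if_same.
have /colP/(_ i') : Q *m x = 0 by rewrite x0 mulmx0.
by rewrite /x mulKVmx // !mxE !eqxx.
Qed.

(** * Choice of $B$ and derivation of the five assertions *)

Theorem theorem4p5 (n : nat) (hn : (2 <= n)%N) (G : vectType CC)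
  (br : G -> G -> G) (form : G -> G -> CC) (h : {vspace G})
  (HLie : is_lie_bracket br) (Hsimple : is_simple_lie br)
  (Hcartan : is_cartan br h) (Hform : is_nondeg_invariant_form br form)
  (V : lmodType CC) (rho : tau_ops n G V)
  (Hmod : is_tau_module br form rho) (Hirr : irreducible rho)
  (Hwt : fin_wt rho h (fun v => v = 0) (fun _ => True))
  (k : nat) (Hk : L_span_dim (Lset rho) k) :
  exists B : 'M[int]_n, B \in unitmx /\
    [/\ (* (1) *)
        (forall i : 'I_n, (i < k)%N -> exists m : int, m != 0 /\
           exists z : V -> V, central_op (twist B rho) (unit_deg i m) z /\
             exists v, z v != 0),
        (* (2) *) (k < n)%N,
        (* (3) *)
        (forall (i : 'I_n) (r : 'cV[int]_n),
           (exists j : 'I_n, (k <= j)%N /\ r j 0 != 0) ->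
           forall v, opK (twist B rho) r i v = 0),
        (* (4) *)
        (forall i : 'I_n, (i < k)%N -> forall r v, opK (twist B rho) r i v = 0)
      & (* (5) *)
        exists W : V -> Prop, is_subspace W /\ (exists v, ~ W v) /\
          invariant_sub (twist B rho) (fun j => (k <= j)%N) W /\
          fin_wt (twist B rho) h W (fun j => (k <= j)%N)].
Proof.
have [s [sL [spanL dimL]]] := Hk; have [t [ts ft et]] := free_subfamily s.
have tk : size t = k by rewrite -dimL -et; apply/esym/eqP.
have kn : (k <= n)%N.
  rewrite -dimL; apply: leq_trans (dimvS (subvf _)) _.
  by rewrite dimvf dim_matrix mulr1.
(* The sign allowed in $L$ is absorbed into the lattice vector; degrees are closed under
   negation. *)
have tL (j : 'I_k) : exists r : 'cV[int]_n, [/\ cast_cV r = t`_j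
    & exists q i v, opK rho q i v != 0 /\ (r = q \/ r = - q)].
  have /ts/sL[q [[i [v nq]] [e|e]]] : t`_j \in t by rewrite mem_nth ?tk.
    by exists q; split=> //; exists q, i, v; split=> //; left.
  exists (- q); split; last by exists q, i, v; split=> //; right.
  by rewrite e; apply/colP => l; rewrite !mxE /icast rmorphN.
have {tL} /choice[u /all_and2[uc uq]] := tL.
have ft' : free (Tuple (introT eqP tk)) by [].
have ind (x : 'I_k -> int) : \sum_j u j *~ x j = 0 -> forall j, x j = 0.
  move=> x0 j; apply: icast_inj; move/freeP: ft' => /(_ (fun j => icast (x j))).
  apply; rewrite (eq_bigr (fun j => icast (x j) *: cast_cV (u j))).
    apply/colP => l; rewrite summxE mxE.
    have /colP/(_ l)/(congr1 icast) := x0; rewrite summxE mxE /icast rmorph_sum.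
    move=> /= e; rewrite -[RHS]e; apply: eq_bigr => i _.
    by rewrite -[u i *~ x i]scaler_int !mxE intz /icast rmorphM.
  by move=> i _; rewrite uc.
have [B uB [Brow Bdeg]] := adapted_basis ind.
have Tmod := twist_tau_module uB Hmod.
have Tirr := twist_irreducible uB Hirr.
have Twt := twist_fin_wt uB Hwt.
have udeg j : K_degree (twist B rho) (invmx B *m u j).
  have [q [i [v [nq [->|->]]]]] := uq j; have [l nl] := opK_twist_ne0 uB nq.
    exact: (K_degree_opK Tmod nl).
  by rewrite mulmxN; apply: (K_degreeN Tmod Tirr); apply: (K_degree_opK Tmod nl).
have part3 (i : 'I_n) (r : 'cV[int]_n) :
    (exists j : 'I_n, (k <= j)%N /\ r j 0 != 0) ->
    forall v, opK (twist B rho) r i v = 0.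
  (* If $t^rK_i$ were nonzero, $Br$ would lie in the span of the [u j], which the $j$-th row of
     $B^{-1}$ kills for $j\ge k$; hence $r_j=0$. *)
  move=> [j [kj nr]] v; apply: contrapT => /eqP /twist_opK_ne0[l nl].
  have : cast_cV (B *m r) \in <<t>>%VS.
    rewrite et; apply: spanL; exists (B *m r).
    by split; [exists l, v|left].
  rewrite -[t]/(tval (in_tuple t)) => /coord_span e.
  case/eqP: nr; apply: icast_inj; rewrite -[r](mulKmx uB) icast_mulmx.
  under eq_bigr => q _.
    have -> : icast ((B *m r) q 0) = cast_cV (B *m r) q 0 by rewrite [RHS]mxE.
    rewrite e summxE mulr_sumr.
    over.
  rewrite exchange_big big1 //= => p _.
  have pk : (p < k)%N by rewrite -tk.
  rewrite -(uc (Ordinal pk)).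
  under eq_bigr => q _ do rewrite !mxE mulrCA.
  by rewrite -mulr_sumr -icast_mulmx Brow // mulr0.
have zs (i : 'I_n) : exists mz : int * (V -> V) * (V -> V), (i < k)%N ->
    [/\ mz.1.1 != 0, K_central (twist B rho) (unit_deg i mz.1.1) mz.1.2,
      central_op (twist B rho) (- unit_deg i mz.1.1) mz.2,
      cancel mz.1.2 mz.2 & cancel mz.2 mz.1.2].
  (* For $i\ge k$ a dummy triple is supplied, so that choice applies to all indices. *)
  have [ik|] := boolP (i < k)%N; last by exists (0, id, id).
  have [m [c [nm me]]] := Bdeg i ik.
  have [z Kz] : K_degree (twist B rho) (unit_deg i m).
    by rewrite me; apply: (K_degree_comb Tmod Tirr).
  have [cz [nz _]] := Kz; have [zi [ziK zK czi]] := central_op_inverse Tmod Tirr cz nz.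
  by exists (m, z, zi).
have {zs} /choice[mz mzP] := zs.
pose m i := (mz i).1.1; pose z i := (mz i).1.2; pose zi i := (mz i).2.
have m_ne0 (i : 'I_n) : (i < k)%N -> m i != 0 by case/mzP.
have Kz (i : 'I_n) : (i < k)%N -> K_central (twist B rho) (unit_deg i (m i)) (z i).
  by case/mzP.
have cz (i : 'I_n) : (i < k)%N -> central_op (twist B rho) (unit_deg i (m i)) (z i).
  by case/Kz.
have czi (i : 'I_n) : (i < k)%N -> central_op (twist B rho) (- unit_deg i (m i)) (zi i).
  by case/mzP.
have ziK (i : 'I_n) : (i < k)%N -> cancel (z i) (zi i) by case/mzP.
have zK (i : 'I_n) : (i < k)%N -> cancel (zi i) (z i) by case/mzP.
have zz (i j : 'I_n) : (i < k)%N -> (j < k)%N -> forall v, z i (z j v) = z j (z i v).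
  (* The central operator $z_i$ commutes with all $t^rK_l$, and $z_j$ lies in their bicommutant. *)
  move=> ik jk; have [lz [_ [zKK _]]] := cz i ik; have [_ [_ bj]] := Kz j jk.
  by apply: bj => // r l v; rewrite zKK.
have part4 (i : 'I_n) : (i < k)%N -> forall r v, opK (twist B rho) r i v = 0.
  move=> ik; have [_ [nz _]] := Kz i ik.
  exact: (opK_eq0_of_central HLie Hsimple Hcartan Hform Tmod Tirr Twt
    (m_ne0 i ik) (cz i ik) nz).
exists B; split=> //; split=> //.
- move=> i ik; exists (m i); split; first exact: m_ne0.
  by exists (z i); split; [apply: cz|have [_ [nz _]] := Kz i ik].
(* If $k=n$, then $k>0$ and [u] provides a nonzero $t^qK_i$, contradicting (4). *)
- rewrite ltn_neqAle kn andbT; apply/eqP => e.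
  have k0 : (0 < k)%N by rewrite e; apply: leq_trans hn.
  have [q [i [v [/(opK_twist_ne0 uB)[l nl] _]]]] := uq (Ordinal k0).
  by rewrite part4 ?eqxx // e in nl.
- exists (per_sub k z); split; first exact: (per_subspace cz).
  split; first exact: (per_sub_proper Tmod Tirr Twt m_ne0 cz czi ziK zK zz).
  split; first exact: (per_sub_invariant Tmod cz).
  exact: (per_sub_fin_wt Tmod Tirr Twt m_ne0 cz czi zK).
Qed.
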